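(* Let $0\le c<h$ be integers. Suppose there is a $\mathcal P$-value $a$ such that $c<a\le h$. (In particular, this applies when $h$ is a $\mathcal P$-value and when $c<h$ are both $\mathcal P$-values.) Consider the Steinberg lattices $I(c)$ and $I(h)$ and let $T^c=I(c)/\ell I(c)$ and $T^h=I(h)/\ell I(h)$ be their respective reductions modulo $\ell$. Then the $KG$-modules $T^c$ and $T^h$ are not isomorphic. Consequently, the $RG$-modules $I(c)$ and $I(h)$ are not isomorphic. On the other hand, with $b=\nu_\ell([G:B])$, one has $I(b)\cong I(b+1)\cong I(b+2)\cong\cdots$, so $T^b\cong T^{b+1}\cong T^{b+2}\cong\cdots$.
   Context: Let $n\ge 2$ and $G=\mathrm{GL}_n(q)$, the general linear group over the finite field $F_q$ of characteristic $p$. Let $\ell\ne p$ be a prime, and let $R$ be a local principal ideal domain of characteristic $0$ with maximal ideal $\ell R$, containing a primitive $p$-th root of unity; $K=R/\ell R$. Modules are left modules. $\nu_\ell$ denotes the $\ell$-adic valuation of integers. $B$ is the group of upper triangular matrices in $G$; $S_n$ is viewed as the subgroup of permutation matrices of $G$; $\widehat{S}=\sum_{s\in S}s\in RG$ for $S\subseteq G$. Put $\varepsilon=\sum_{\sigma\in S_n}\mathrm{sg}(\sigma)\,\sigma\widehat{B}\in RG$, and $I=RG\cdot\varepsilon$ (the Steinberg lattice). Let $f:I\times I\to R$ be the restriction to $I$ of the $R$-bilinear form on $RG$ given by $(g,h)\mapsto\delta_{g,h}$ for $g,h\in G$, scaled by $1/|B|$ (it takes values in $R$). For $c\ge 0$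 put $I(c)=\{x\in I : f(x,I)\subseteq \ell^cR\}$ and $T^c=I(c)/\ell I(c)$. A Steinberg lattice of $G$ over $R$ is an $RG$-module that is $R$-free of rank $q^{n(n-1)/2}$ and affords the Steinberg character; each $I(c)$ is one. $\mathcal P$ is the set of standard parabolic subgroups (subgroups of $G$ containing $B$); a $\mathcal P$-value is an integer of the form $\nu_\ell([G:P])$ with $P\in\mathcal P$. *)

(* Defs.v *)
From HB Require Import structures.
From mathcomp Require Import all_boot all_order all_algebra all_fingroup.
From mathcomp Require Import ring_quotient generic_quotient fraction.
From mathcomp Require Import boolp.

Set Implicit Arguments.
Unset Strict Implicit.
Unset Printing Implicit Defensive.

Import GRing.Theory.
Local Open Scope ring_scope.
Local Open Scope quotient_scope.

Local Notation "x %:F" := (FracField.tofrac x).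

(* Quantifying over boolean predicates loses no generality: every Prop is
   reflected by a boolean thanks to boolp.  idealr_closed describes the proper
   ideals; the unit ideal is principal anyway. *)
Definition principal_ideal_ring (R : comNzRingType) : Prop :=
  forall J : {pred R}, idealr_closed J ->
    exists a : R, forall x, (x \in J) <-> exists r, x = r * a.

Definition maximal_ideal (R : comNzRingType) (J : {pred R}) : Prop :=
  idealr_closed J /\
  forall J' : {pred R}, idealr_closed J' -> {subset J <= J'} -> J' =i J.

Definition local_ring_with_maximal_ideal (R : comNzRingType) (M : {pred R}) :
    Prop :=
  maximal_ideal M /\ forall J : {pred R}, maximal_ideal J -> J =i M.

Definition lmod_iso (A : pzRingType) (U V : lmodType A) : Prop :=
  exists f : {linear U -> V}, bijective f.

(* A new type, because {ffun gT -> A} already carries the pointwise product. *)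
Definition group_ring (A : pzRingType) (gT : finGroupType) : Type :=
  {ffun gT -> A}.

Section GroupRing.
Variables (A : pzRingType) (gT : finGroupType).
Local Notation AG := (group_ring A gT).
Implicit Types x y z : AG.

HB.instance Definition _ := GRing.Zmodule.copy AG {ffun gT -> A}.


Definition gr_elt (g : gT) : AG := [ffun h => (h == g)%:R].
Definition gr_mul x y : AG := [ffun g => \sum_h x h * y (h^-1 * g)%g].

Lemma gr_mulE x y g : gr_mul x y g = \sum_h x h * y (h^-1 * g)%g.
Proof. by rewrite /gr_mul ffunE. Qed.

Lemma gr_eltE g h : gr_elt g h = (h == g)%:R.
Proof. by rewrite ffunE. Qed.

Lemma gr_addE x y g : (x + y) g = x g + y g.
Proof. by rewrite ffunE. Qed.

Lemma gr_ext x y : (forall g, x g = y g) -> x = y.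
Proof. by move=> e; apply/ffunP=> g; exact: e. Qed.

Fact gr_mulA : associative gr_mul.
Proof.
move=> x y z; apply: gr_ext => g; rewrite !gr_mulE.
under eq_bigr => h _ do rewrite gr_mulE big_distrr /=.
under [RHS]eq_bigr => h _ do rewrite gr_mulE big_distrl /=.
rewrite [RHS]exchange_big /=; apply: eq_bigr => h _.
rewrite [RHS](reindex_inj (mulgI h)) /=; apply: eq_bigr => k _.
by rewrite mulKg invMg !mulgA mulrA.
Qed.

Fact gr_mul1 : left_id (gr_elt 1%g) gr_mul.
Proof.
move=> x; apply: gr_ext => g; rewrite gr_mulE (bigD1 1%g) //= big1 => [|h hN1].
  by rewrite ffunE eqxx mul1r invg1 mul1g addr0.
by rewrite ffunE (negPf hN1) mul0r.
Qed.

Fact gr_mulr1 : right_id (gr_elt 1%g) gr_mul.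
Proof.
move=> x; apply: gr_ext => g; rewrite gr_mulE (bigD1 g) //= big1 => [|h hNg].
  by rewrite ffunE mulVg eqxx mulr1 addr0.
rewrite ffunE -(inj_eq (mulgI h)) mulKVg mulg1.
by rewrite eq_sym (negPf hNg) mulr0.
Qed.

Fact gr_mulDl : left_distributive gr_mul +%R.
Proof.
move=> x y z; apply: gr_ext => g; rewrite gr_addE !gr_mulE -big_split /=.
by apply: eq_bigr => h _; rewrite gr_addE mulrDl.
Qed.

Fact gr_mulDr : right_distributive gr_mul +%R.
Proof.
move=> x y z; apply: gr_ext => g; rewrite gr_addE !gr_mulE -big_split /=.
by apply: eq_bigr => h _; rewrite gr_addE mulrDr.
Qed.

HB.instance Definition _ := GRing.Zmodule_isPzRing.Build AG
  gr_mulA gr_mul1 gr_mulr1 gr_mulDl gr_mulDr.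

Definition gr_sum (S : {set gT}) : AG := \sum_(g in S) gr_elt g.

End GroupRing.

Arguments gr_elt A {gT} g.
Arguments gr_sum A {gT} S.

Definition nat_multiples (V : zmodType) (l : nat) : {pred V} :=
  fun x => `[< exists y, x = y *+ l >].

Arguments nat_multiples : clear implicits.

Fact nat_multiples_zmod_closed (V : zmodType) l :
  zmod_closed (nat_multiples V l).
Proof.
split=> [|x y /asboolP[u ->] /asboolP[v ->]]; apply/asboolP.
  by exists 0; rewrite mul0rn.
by exists (u - v); rewrite mulrnBl.
Qed.

HB.instance Definition _ (V : zmodType) l :=
  GRing.isZmodClosed.Build V (nat_multiples V l)
    (@nat_multiples_zmod_closed V l).

Definition reduction (V : zmodType) (l : nat) : Type :=
  Quotient.quot (nat_multiples V l).

HB.instance Definition _ (V : zmodType) l := GRing.Zmodule.on (reduction V l).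
HB.instance Definition _ (V : zmodType) l :=
  ZmodQuotient.on (reduction V l).

Definition red (V : zmodType) (l : nat) (x : V) : reduction V l :=
  \pi_(reduction V l) x.

Section Reduction.
Variables (V : zmodType) (l : nat).
Local Notation red := (@red V l).

Lemma redP (x y : V) : red x = red y <-> exists z, x - y = z *+ l.
Proof.
split=> [/eqP|[z e]]; first by rewrite -Quotient.idealrBE => /asboolP.
by apply/eqP; rewrite -Quotient.idealrBE; apply/asboolP; exists z.
Qed.

Lemma red_repr (t : reduction V l) : red (repr t) = t.
Proof. exact: reprK. Qed.

Lemma repr_red (x : V) : exists z, repr (red x) = x + z *+ l.
Proof.
have /redP[z e] : red (repr (red x)) = red x by rewrite red_repr.
by exists z; rewrite -e addrC subrK.
Qed.

Lemma redD (x y : V) : red (x + y) = red x + red y.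
Proof. exact: (raddfD \pi_(reduction V l)). Qed.

End Reduction.

(* Only a ring in general, possibly trivial; a field when lR is maximal. *)
Section ReductionRing.
Variables (R : comPzRingType) (l : nat).
Local Notation K := (reduction R l).
Local Notation red := (@red R l).

Definition red_one : K := red 1.
Definition red_mul (s t : K) : K := red (repr s * repr t).

Lemma redM x y : red (x * y) = red_mul (red x) (red y).
Proof.
rewrite /red_mul; have [u ->] := repr_red l x; have [v ->] := repr_red l y.
apply/redP; exists (- (x * v + u * y + u * v *+ l)).
rewrite mulrDl !mulrDr !mulrnAr !mulrnAl mulNrn !mulrnDl.
by rewrite !opprD !addrA subrr add0r.
Qed.

Fact red_mulA : associative red_mul.
Proof.
by move=> r s t; rewrite -[r]red_repr -[s]red_repr -[t]red_repr -!redM mulrA.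
Qed.

Fact red_mulC : commutative red_mul.
Proof. by move=> s t; rewrite /red_mul mulrC. Qed.

Fact red_mul1 : left_id red_one red_mul.
Proof. by move=> t; rewrite -[t]red_repr -redM mul1r. Qed.

Fact red_mulDl : left_distributive red_mul +%R.
Proof.
move=> r s t; rewrite -[r]red_repr -[s]red_repr -[t]red_repr.
by rewrite -redD -!redM -redD mulrDl.
Qed.

HB.instance Definition _ := GRing.Zmodule_isComPzRing.Build K
  red_mulA red_mulC red_mul1 red_mulDl.

End ReductionRing.

(* M/lM is a module over (R/lR)[gT], not only over R[gT]; red_scaleE states
   that red_scale is the scaling induced by that of M. *)
Section ReductionModule.
Variables (R : comPzRingType) (gT : finGroupType) (l : nat).
Variable M : lmodType (group_ring R gT).
Local Notation RG := (group_ring R gT).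
Local Notation KG := (group_ring (reduction R l) gT).

Definition gr_red (a : RG) : KG := [ffun g => red l (a g)].
Definition gr_lift (k : KG) : RG := [ffun g => repr (k g)].
Definition red_scale (k : KG) (t : reduction M l) : reduction M l :=
  red l (gr_lift k *: repr t).

Lemma gr_redE a g : gr_red a g = red l (a g).
Proof. by rewrite /gr_red ffunE. Qed.

Lemma gr_liftE k g : gr_lift k g = repr (k g).
Proof. by rewrite /gr_lift ffunE. Qed.

Lemma gr_liftK k : gr_red (gr_lift k) = k.
Proof. by apply: gr_ext => g; rewrite gr_redE gr_liftE red_repr. Qed.

Lemma gr_lift_red a : exists b : RG, gr_lift (gr_red a) = a + b *+ l.
Proof.
have /fin_all_exists[b eb] g : exists z, gr_lift (gr_red a) g = a g + z *+ l.
  by rewrite gr_liftE gr_redE; apply: repr_red.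
exists [ffun g => b g]; apply: gr_ext => g; rewrite eb gr_addE.
by rewrite ffunMnE ffunE.
Qed.

Lemma red_scaleE a x : red l (a *: x) = red_scale (gr_red a) (red l x).
Proof.
rewrite /red_scale; have [b ->] := gr_lift_red a; have [y ->] := repr_red l x.
apply/redP; exists (- (a *: y + b *: x + (b *: y) *+ l)).
rewrite scalerDl !scalerDr -!scalerMnr -!scalerMnl mulNrn !mulrnDl.
by rewrite !opprD !addrA subrr add0r.
Qed.

Lemma gr_redD a b : gr_red (a + b) = gr_red a + gr_red b.
Proof. by apply: gr_ext => g; rewrite gr_addE !gr_redE gr_addE redD. Qed.

Lemma red_sum (I : finType) (E : I -> R) :
  red l (\sum_i E i) = \sum_i red l (E i).
Proof. exact: (raddf_sum \pi_(reduction R l)). Qed.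

Lemma gr_redM a b : gr_red (a * b) = gr_red a * gr_red b.
Proof.
apply: gr_ext => g; rewrite gr_redE !gr_mulE red_sum.
by apply: eq_bigr => h _; rewrite !gr_redE redM.
Qed.

Lemma gr_red1 : gr_red 1 = 1.
Proof.
apply: gr_ext => g; rewrite gr_redE !gr_eltE; case: (g == 1%g) => //.
exact: (raddf0 \pi_(reduction R l)).
Qed.

Fact red_scaleA a b t : red_scale a (red_scale b t) = red_scale (a * b) t.
Proof.
rewrite -[t]red_repr -[a]gr_liftK -[b]gr_liftK -gr_redM.
rewrite -(red_scaleE _ (repr t)) -(red_scaleE (gr_lift a)).
by rewrite -(red_scaleE _ (repr t)) scalerA.
Qed.

Fact red_scale1 : left_id 1 red_scale.
Proof. by move=> t; rewrite -[t]red_repr -gr_red1 -red_scaleE scale1r. Qed.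

Fact red_scaleDr : right_distributive red_scale +%R.
Proof.
move=> a s t; rewrite -[s]red_repr -[t]red_repr -[a]gr_liftK.
by rewrite -redD -!red_scaleE -redD scalerDr.
Qed.

Fact red_scaleDl t : {morph red_scale^~ t : a b / a + b}.
Proof.
move=> a b; rewrite -[t]red_repr -[a]gr_liftK -[b]gr_liftK -gr_redD.
by rewrite -!red_scaleE -redD scalerDl.
Qed.

HB.instance Definition _ := GRing.Zmodule_isLmodule.Build KG (reduction M l)
  red_scaleA red_scale1 red_scaleDr red_scaleDl.

End ReductionModule.

Section Borel.
Variables (n : nat) (F : finFieldType).
Local Notation GL := {'GL_n[F]}.

(* is_trig_mx means lower triangular. *)
Definition borel : {set GL} := [set g : GL | is_trig_mx (GLval g)^T].

Fact borel_group_set : group_set borel.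
Proof.
apply/group_setP; split=> [|g h].
  by rewrite inE GL_1E trmx1 scalar_mx_is_trig.
rewrite !inE GL_MxE trmx_mul => /is_trig_mxP tg /is_trig_mxP th.
apply/is_trig_mxP => i j ltij; rewrite mxE big1 // => k _.
have [ltik|leki] := ltnP i k; first by rewrite th ?mul0r.
by rewrite tg ?mulr0 // (leq_ltn_trans leki).
Qed.
Canonical borel_group := Group borel_group_set.

Definition P_value (l a : nat) : Prop :=
  exists P : {group GL}, borel \subset P /\ a = logn l #|'GL_n[F] : P|%g.

(* perm_mx s and perm_mx s^-1 are exchanged by the two usual identifications of
   permutations with matrices; s and s^-1 have the same sign. *)
Definition perm_GL (s : 'S_n.-1.+1) : GL := Sub (perm_mx s) (unitmx_perm F s).

End Borel.

Arguments borel : clear implicits.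
Arguments borel_group : clear implicits.
Arguments P_value : clear implicits.

Section Steinberg.
Variables (n : nat) (F : finFieldType) (R : idomainType).
Local Notation GL := {'GL_n[F]}.
Local Notation RG := (group_ring R GL).

Definition steinberg_elt : RG :=
  \sum_(s : 'S_n.-1.+1) (-1) ^+ s * gr_elt R (perm_GL F s) * gr_sum R (borel n F).

Definition steinberg_ideal : {pred RG} :=
  fun x => `[< exists a : RG, x = a * steinberg_elt >].

(* Dividing by |B| takes place in the fraction field of R; x and y range over
   all of RG, but only the restriction to steinberg_ideal is used. *)
Definition steinberg_form (x y : RG) : {fraction R} :=
  (\sum_g x g * y g)%:F / #|borel n F|%:R.

(* f(x, I) \subset l^c R, where l^c R is regarded inside the fraction field. *)
Definition lattice_pred (l c : nat) : {pred RG^o} :=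
  fun x => `[< x \in steinberg_ideal /\
    forall y, y \in steinberg_ideal ->
      exists r : R, steinberg_form x y = (l%:R ^+ c * r)%:F >].

Definition gr_adj (a : RG) : RG := [ffun g => a g^-1%g].

Lemma gr_adjP (a x y : RG) :
  \sum_g (a * x) g * y g = \sum_g x g * (gr_adj a * y) g.
Proof.
under eq_bigr => g _ do rewrite gr_mulE big_distrl /=.
under [RHS]eq_bigr => g _ do rewrite gr_mulE big_distrr /=.
rewrite exchange_big [RHS]exchange_big /= [RHS](reindex_inj invg_inj) /=.
apply: eq_bigr => h _; rewrite (reindex_inj (mulgI h)) /=.
apply: eq_bigr => g _; rewrite mulKg invgK.
by rewrite /gr_adj ffunE invgK mulrCA mulrA.
Qed.

Fact lattice_submod_closed l c :
  submod_closed (lattice_pred l c).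
Proof.
split=> [|a x y /asboolP[xI fx] /asboolP[yI fy]]; apply/asboolP; split.
- by apply/asboolP; exists 0; rewrite mul0r.
- move=> y _; exists 0; rewrite mulr0 /steinberg_form big1 => [|g _].
    by rewrite rmorph0 mul0r.
  by rewrite ffunE mul0r.
- have [[u ->] [v ->]] := (asboolP _ xI, asboolP _ yI).
  by apply/asboolP; exists (a * u + v); rewrite mulrDl -mulrA.
move=> z zI; have azI : gr_adj a * z \in steinberg_ideal.
  have [w ->] := asboolP _ zI.
  by apply/asboolP; exists (gr_adj a * w); rewrite mulrA.
have [[r er] [s es]] := (fx _ azI, fy _ zI).
exists (r + s); rewrite mulrDr rmorphD /= -er -es /steinberg_form -mulrDl.
rewrite -rmorphD -gr_adjP -big_split /=; congr (_%:F / _).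
by apply: eq_bigr => g _; rewrite gr_addE mulrDl.
Qed.

HB.instance Definition _ l c := GRing.isSubmodClosed.Build RG RG^o
  (lattice_pred l c) (lattice_submod_closed l c).

Definition lattice (l c : nat) : Type := {x : RG^o | lattice_pred l c x}.

HB.instance Definition _ l c := [isSub of lattice l c for @sval _ _].
HB.instance Definition _ l c := [Choice of lattice l c by <:].
HB.instance Definition _ l c := [SubChoice_isSubLmodule of lattice l c by <:].

End Steinberg.

Arguments lattice : clear implicits.

(* Main.v *)
Require Import Defs.
From HB Require Import structures.
From mathcomp Require Import all_boot all_order all_algebra all_fingroup.
From mathcomp Require Import generic_quotient fraction finfield boolp zify ring.

Set Implicit Arguments.
Unset Strict Implicit.
Unset Printing Implicit Defensive.

Import GRing.Theory.
Local Open Scope ring_scope.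

(** Let U be the upper unitriangular group, B the Borel subgroup, w s the
permutation matrix of s, w0 the order-reversing permutation, eps the Steinberg
element and f the form.  The two reductions are told apart by the action of a
single element of the group ring.

As a function on G, an element of the Steinberg ideal is constant on the cosets
of B and has sum zero over each panel, that is, over the cosets of B inside a
coset of a minimal parabolic subgroup (steinberg_ideal_panel).  By the Bruhat
decomposition it is then determined by its values on U w0
(steinberg_ideal_unitri), and the ideal is RU . eps.  So, for a linear character
lam of U, the element E_lam = \sum_(u in U) lam u . u maps the ideal into the
line spanned by e_lam = E_lam eps (char_sum_mul).

Fix a nontrivial additive character chi of the field.  For a parabolic subgroup
P take lam_P to be chi of the sum of those superdiagonal entries that belong to
the Levi blocks of P.  Expanding over permutations,
  f(e_lam, eps) = \sum_s \sum_(u in U, (w s)^-1 u (w s) in U) lam u;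
for lam_P only the permutations decreasing on the blocks of P survive, and
counting the double cosets P \ G / U identifies the sum with |G : P|
(apt_sum_parchar).  The adjoint of E_lam is the corresponding element for the
inverse character, so that all values of f on e_lam_P and the ideal are
multiples of |G : P| (apt_sum_mul_char_vec).  For P = G the index is 1.

If y is the permutation matrix that reverses the order of the blocks of P, then
E_lam_P y^-1 e_lam_G = r e_lam_P where r divides |U|, a power of p
(char_sum_reversal).  Let E and E' belong to the inverses of the characters
lam_G and lam_P, and put e = E eps, e' = E' eps and X = E y E'.  Then X maps the
ideal into |G : P| R e, and f(X e', eps) is |G : P| up to a factor that divides
a power of p.  Let a be the l-adic valuation of |G : P|.  When c < a, X maps
I(c) into l I(c), because l^c e lies in I(c) (sep_elt_kills).  When a <= h, the
vector l^(h-a) e' lies in I(h), and f(X l^(h-a) e', eps) is l^h times an element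
outside lR, so that X does not map I(h) into l I(h) (sep_elt_survives).  Hence
T^c and T^h are not isomorphic, and neither are the lattices.

For the trivial character lam and any x in the ideal,
f(E_lam g^-1 x, eps) = |G : B| x(g) (index_value).  If x lies in I(m+1) and m is at
least the valuation of |G : B|, all values of x are divisible by l, and
x = l x' with x' in the ideal since the coordinates of x on the basis u . eps
are among its values.  So I(m+1) = l I(m), and multiplication by l is an
isomorphism I(m) -> I(m+1). *)

(** * Identities in groups *)

Lemma group_inv_closed (gT : finGroupType) (G : {group gT}) x :
  x \in G -> (x^-1)%g \in G.
Proof. exact: groupVr. Qed.

Lemma group_mul_closed (gT : finGroupType) (G : {group gT}) x y :
  x \in G -> y \in G -> (x * y)%g \in G.
Proof. exact: groupM. Qed.

Lemma mulg_isolate_middle (gT : groupType) (p a u p' b u' : gT) :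
  (p * a * u = p' * b * u' -> a = p^-1 * p' * b * (u' * u^-1))%g.
Proof.
by move=> e; apply: (mulgI p); apply: (mulIg u); rewrite e !mulgA mulgV mul1g mulgKV.
Qed.

Lemma invol_mulV (gT : groupType) (a b c g : gT) :
  (c = a * b -> b * b = 1 -> c^-1 * g = b * (a^-1 * g))%g.
Proof.
by move=> -> bb; rewrite invMg -mulgA; congr (_ * _)%g; apply: (mulgI b); rewrite bb mulgV.
Qed.

Lemma mulg_divK (gT : groupType) (u a b : gT) :
  (a = u * b * (a^-1 * (u * b))^-1)%g.
Proof. by rewrite invMg invgK mulgA mulgV mul1g. Qed.

Lemma mulV_cancel (gT : groupType) (g u : gT) : ((g * u^-1)^-1 * g = u)%g.
Proof. by rewrite invMg invgK mulgKV. Qed.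

Lemma conj_split (gT : groupType) (y g a b : gT) :
  (y * g * y^-1 = a * b -> g = (y^-1 * a * y) * (y^-1 * b * y))%g.
Proof.
by move=> e; rewrite !mulgA mulgK -[(y^-1 * a * b)%g]mulgA -e !mulgA mulVg mul1g mulgKV.
Qed.

Lemma conj_assoc (gT : groupType) (y g a b c : gT) :
  (y * g * y^-1 = a * b -> y * (g * (y^-1 * c)) = a * (c * (c^-1 * b * c)))%g.
Proof. by move=> e; rewrite !mulgA e mulgK. Qed.

(** Translating by e multiplies the sum by lam e, which is not 1. *)
Lemma sum_group_char0 (R : idomainType) (gT : finGroupType) (G : {group gT})
    (lam : gT -> R) e :
  {in G &, {morph lam : u v / (u * v)%g >-> u * v}} -> e \in G -> lam e != 1 ->
  \sum_(u in G) lam u = 0.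
Proof.
move=> lamM eG lam_e; set S := \sum_(u in G) _.
have SE : S = lam e * S.
  rewrite {1}/S (reindex_inj (mulgI e)) /= mulr_sumr.
  by apply: eq_big => u; rewrite groupMl // => uG; rewrite lamM.
have : (lam e - 1) * S = 0 by rewrite mulrBl mul1r -SE subrr.
by move/eqP; rewrite mulf_eq0 subr_eq0 (negPf lam_e) => /eqP.
Qed.

(** * Conjugates of the unitriangular group *)

Section Unitriangular.
Variables (n : nat) (F : finFieldType).
Local Notation N := n.-1.+1.
Local Notation GL := {'GL_n[F]}.
Local Notation w := (perm_GL F).
Implicit Types (s t a b : 'S_N) (g h u v : GL) (i j k : 'I_N).

(** This is w s U (w s)^-1, where U = unitri 1; indexing the conjugates by the
order that s induces on the indices makes conjugation by w x the map s -> x s. *)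
Definition unitri s : {set GL} :=
  [set g : GL | [forall i, forall j, ~~ (s i < s j)%N ==> (GLval g i j == (i == j)%:R)]].

Lemma unitriP s g :
  reflect (forall i j, ~~ (s i < s j)%N -> GLval g i j = (i == j)%:R)
          (g \in unitri s).
Proof.
rewrite inE; apply: (iffP forallP) => [H i j ij | H i].
  by move/forallP/(_ j)/implyP/(_ ij)/eqP: (H i).
by apply/forallP=> j; apply/implyP=> ij; apply/eqP/H.
Qed.

Lemma unitri_diag s g i : g \in unitri s -> GLval g i i = 1.
Proof. by move/unitriP=> /(_ i i); rewrite ltnn eqxx; apply. Qed.

Lemma unitri_neq0 s g i j :
  g \in unitri s -> i != j -> GLval g i j != 0 -> (s i < s j)%N.
Proof.
move/unitriP=> gU ij; apply: contraNT => /gU ->.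
by rewrite (negPf ij).
Qed.

Lemma unitri_eq0 s g i j :
  g \in unitri s -> i != j -> ~~ (s i < s j)%N -> GLval g i j = 0.
Proof. by move/unitriP=> gU ij /gU ->; rewrite (negPf ij). Qed.

Fact unitri_group_set s : group_set (unitri s).
Proof.
apply/group_setP; split=> [|g h gU hU].
  by apply/unitriP=> i j _; rewrite GL_1E mxE.
apply/unitriP=> i j nij; rewrite GL_MxE mxE (bigD1 i) //= (unitri_diag _ gU).
rewrite mul1r (unitriP _ _ hU) // big1 ?addr0 // => k ki.
have [-> | gik] := eqVneq (GLval g i k) 0; first by rewrite mul0r.
have ik : (s i < s k)%N by apply: unitri_neq0 gik; rewrite // eq_sym.
have [kj | kj] := eqVneq k j; first by rewrite -kj ik in nij.
rewrite (unitri_eq0 hU) ?mulr0 //; apply: contra nij; exact: ltn_trans ik.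
Qed.
Canonical unitri_group s := Group (unitri_group_set s).

Lemma GL_mulE g h i j : GLval (g * h)%g i j = \sum_k GLval g i k * GLval h k j.
Proof. by rewrite GL_MxE mxE. Qed.

Lemma borelP g :
  reflect (forall i j, (j < i)%N -> GLval g i j = 0) (g \in borel n F).
Proof.
rewrite inE; apply: (iffP is_trig_mxP) => H i j ij.
  by have := H j i ij; rewrite mxE.
by rewrite mxE H.
Qed.

Lemma borelV g : g \in borel n F -> (g^-1)%g \in borel n F.
Proof. exact: (@group_inv_closed _ (borel_group n F)). Qed.

Lemma borelM g h : g \in borel n F -> h \in borel n F -> (g * h)%g \in borel n F.
Proof. exact: (@group_mul_closed _ (borel_group n F)). Qed.

Lemma unitriV s g : g \in unitri s -> (g^-1)%g \in unitri s.
Proof. exact: (@group_inv_closed _ (unitri_group s)). Qed.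

Lemma unitriM s g h : g \in unitri s -> h \in unitri s -> (g * h)%g \in unitri s.
Proof. exact: (@group_mul_closed _ (unitri_group s)). Qed.

Lemma unitri_sub_borel : unitri 1 \subset borel n F.
Proof.
apply/subsetP=> g gU; apply/borelP=> i j ji.
rewrite (unitri_eq0 gU) ?perm1 //; last by rewrite -leqNgt ltnW.
by rewrite -val_eqE gtn_eqF.
Qed.

Lemma borel_diag_neq0 g i : g \in borel n F -> GLval g i i != 0.
Proof.
rewrite inE => gB; have := GL_det g; rewrite -det_tr (det_trig gB).
by move/prodf_neq0/(_ i isT); rewrite mxE.
Qed.

(** Diagonal entries are 1 on the left factor, hence no torus part remains. *)
Lemma unitri_cap_borel s : unitri s :&: borel n F \subset unitri 1.
Proof.
apply/subsetP=> g /setIP[gU /borelP gB]; apply/unitriP=> i j.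
rewrite !perm1 -leqNgt leq_eqVlt => /predU1P[/val_inj->|ji].
  by rewrite (unitri_diag _ gU) eqxx.
by rewrite gB // -val_eqE gtn_eqF.
Qed.

Lemma perm_GLM s t : w (s * t)%g = (w s * w t)%g.
Proof. by apply: val_inj; rewrite /= perm_mxM. Qed.

Lemma perm_GL1 : w 1%g = 1%g :> GL.
Proof. by apply: val_inj; rewrite /= perm_mx1. Qed.

Lemma perm_GLV s : w s^-1 = (w s)^-1%g.
Proof. by apply: (mulgI (w s)); rewrite -perm_GLM !mulgV perm_GL1. Qed.

Lemma perm_mulE s g i j : GLval (w s * g)%g i j = GLval g (s i) j.
Proof. by rewrite [LHS](congr1 (fun A : 'M_N => A i j) (GL_MxE _ _)) -row_permE mxE. Qed.

Lemma mul_permE s g i j : GLval (g * w s)%g i j = GLval g i ((s^-1)%g j).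
Proof.
rewrite GL_MxE /= -[s in perm_mx s]invgK.
by rewrite -col_permE mxE.
Qed.

Lemma permJE x g i j : GLval (w x * g * (w x)^-1)%g i j = GLval g (x i) (x j).
Proof. by rewrite -perm_GLV mul_permE invgK perm_mulE. Qed.

Lemma permJVE x g i j :
  GLval ((w x)^-1 * g * w x)%g i j = GLval g (x^-1 i)%g (x^-1 j)%g.
Proof. by rewrite -perm_GLV mul_permE perm_mulE. Qed.

Lemma unitriJ x s g :
  ((w x * g * (w x)^-1)%g \in unitri (x * s)%g) = (g \in unitri s).
Proof.
apply/unitriP/unitriP=> H i j.
  have := H (x^-1 i)%g (x^-1 j)%g; rewrite permJE !permM !permKV.
  by rewrite (inj_eq perm_inj).
by rewrite !permM permJE => /H ->; rewrite (inj_eq perm_inj).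
Qed.

Lemma unitriJV s g : ((w s)^-1 * g * w s \in unitri 1)%g = (g \in unitri s).
Proof.
rewrite -(unitriJ s 1%g) mulg1 (_ : (w s * _ * (w s)^-1)%g = g) //.
by apply/val_inj/matrixP=> i j; rewrite [LHS]permJE permJVE !permK.
Qed.

(** The longest permutation; unitri (s * w0) is opposite to unitri s. *)
Definition w0 : 'S_N := perm (@rev_ord_inj N).

Lemma w0E i : w0 i = rev_ord i. Proof. by rewrite permE. Qed.

Lemma lt_w0 i j : (w0 i < w0 j)%N = (j < i)%N.
Proof.
rewrite !w0E /=; have := ltn_ord i; have := ltn_ord j.
by move=> ? ?; rewrite ltn_sub2lE.
Qed.

Lemma w0K : (w0 * w0 = 1)%g.
Proof. by apply/permP=> i; rewrite permM perm1 !w0E rev_ordK. Qed.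

Lemma lt_mulw0 s i j : ((s * w0)%g i < (s * w0)%g j)%N = (s j < s i)%N.
Proof. by rewrite !permM lt_w0. Qed.

Lemma unitri_opp_cap s : unitri s :&: unitri (s * w0)%g = 1%g.
Proof.
apply/eqP; rewrite eqEsubset sub1G andbT.
apply/subsetP=> g /setIP[g1 g2]; rewrite inE; apply/eqP/val_inj.
apply/matrixP=> i j; rewrite [RHS]mxE.
have [ij|] := boolP (s i < s j)%N; last exact: (unitriP _ _ g1).
by apply: (unitriP _ _ g2); rewrite lt_mulw0 -leqNgt ltnW.
Qed.

(** Permuting rows and columns by a makes M triangular with diagonal 1. *)
Lemma unitri_mx_unit a (M : 'M[F]_N) :
  (forall i j, ~~ (a i < a j)%N -> M i j = (i == j)%:R) -> M \in unitmx.
Proof.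
move=> HM; pose M' := \matrix_(i, j) M (a^-1 i)%g (a^-1 j)%g.
have -> : M = perm_mx a *m M' *m perm_mx a^-1.
  apply/matrixP=> i j.
  by rewrite -[a^-1%g]invgK -col_permE -row_permE !mxE invgK !permK.
rewrite !unitmx_mul !unitmx_perm andbT /= unitmxE -det_tr det_trig.
  by rewrite big1 ?unitr1 // => i _; rewrite !mxE HM ?ltnn ?eqxx.
apply/is_trig_mxP=> i j ij; rewrite mxE [LHS]mxE HM; last first.
  by rewrite !permKV -leqNgt ltnW.
by rewrite (inj_eq perm_inj) -val_eqE gtn_eqF.
Qed.

Lemma unitri_restr a b g : g \in unitri a ->
  exists2 h, h \in unitri a :&: unitri b &
   forall i j, (b i < b j)%N -> GLval h i j = GLval g i j.
Proof.
move=> gU.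
pose M : 'M[F]_N := \matrix_(i, j) if (b i < b j)%N then GLval g i j else (i == j)%:R.
have HM i j : ~~ (a i < a j)%N -> M i j = (i == j)%:R.
  by move=> ij; rewrite mxE; case: ifP => // _; exact: (unitriP _ _ gU).
exists (Sub M (unitri_mx_unit HM)) => [|i j ij]; last by rewrite /= mxE ij.
rewrite inE; apply/andP; split; apply/unitriP=> i j ij; first exact: HM.
by rewrite /= mxE (negPf ij).
Qed.

(** Entrywise restriction to the pairs increasing for b, respectively
decreasing for b, embeds unitri a in the cartesian product of the two subgroups on
the right; these meet trivially, so counting gives equality. *)
Lemma unitri_decomp a b :
  unitri a = ((unitri a :&: unitri b) * (unitri a :&: unitri (b * w0)))%g.
Proof.
set A := unitri a :&: unitri b; set B := unitri a :&: _.
have cAB : A :&: B = 1%g.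
  by rewrite setIACA setIid unitri_opp_cap; apply/setIidPr; exact: sub1G.
apply/esym/eqP; rewrite eqEcard mul_subG ?subsetIl //=.
have -> : #|(A * B)%g| = (#|A| * #|B|)%N.
  have := mul_cardG (unitri_group a :&: unitri_group b)%G
    (unitri_group a :&: unitri_group (b * w0)%g)%G.
  by rewrite /= -/A -/B cAB cards1 muln1.
have /fin_all_exists[f fP] (g : GL) : exists h, g \in unitri a ->
    h \in A /\ forall i j, (b i < b j)%N -> GLval h i j = GLval g i j.
  by have [/(unitri_restr b)[h]|_] := boolP (g \in unitri a); [exists h | exists g].
have /fin_all_exists[f' fP'] (g : GL) : exists h, g \in unitri a ->
    h \in B /\ forall i j, (b j < b i)%N -> GLval h i j = GLval g i j.
  have [/(unitri_restr (b * w0))[h hB hE]|_] := boolP (g \in unitri a); last by exists g.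
  by exists h => _; split=> // i j; rewrite -lt_mulw0; apply: hE.
have inj : {in unitri a &, injective (fun g => (f g, f' g))}.
  move=> g h gU hU [e e']; apply/val_inj/matrixP=> i j /=.
  have [_ fg] := fP g gU; have [_ fh] := fP h hU.
  have [_ fg'] := fP' g gU; have [_ fh'] := fP' h hU.
  have [ij | ij | ij] := ltngtP (b i) (b j).
  - by rewrite -fg // e fh.
  - by rewrite -fg' // e' fh'.
  - move/val_inj/perm_inj: ij => ->.
    by rewrite !(@unitri_diag a).
rewrite -cardsX -(card_in_imset inj) subset_leq_card //.
apply/subsetP=> _ /imsetP[g gU ->].
by have [fA _] := fP g gU; have [fB _] := fP' g gU; rewrite inE /= fA.
Qed.

Lemma card_unitri_decomp a b :
  #|unitri a| = (#|unitri a :&: unitri b| * #|unitri a :&: unitri (b * w0)|)%N.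
Proof.
have := mul_cardG (unitri_group a :&: unitri_group b)%G
  (unitri_group a :&: unitri_group (b * w0)%g)%G.
rewrite /= -unitri_decomp => ->.
by rewrite setIACA setIid unitri_opp_cap (setIidPr (sub1G _)) cards1 muln1.
Qed.

End Unitriangular.

(** * Bruhat decomposition of the general linear group *)
Section BruhatMatrix.
Variable F : fieldType.

(** M is placed on the rows other than i and the columns other than j; the
entry (i, j) is c and the rest of row i and of column j is zero. *)
Definition ins_mx n (i j : 'I_n.+1) (M : 'M[F]_n) (c : F) : 'M[F]_n.+1 :=
  \matrix_(k, l) match unlift i k, unlift j l with
                 | Some k', Some l' => M k' l'
                 | None, None => c
                 | _, _ => 0
                 end.

Lemma ins_mxM n (i j k : 'I_n.+1) M M' c c' :
  ins_mx i j M c *m ins_mx j k M' c' = ins_mx i k (M *m M') (c * c').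
Proof.
apply/matrixP=> r s; rewrite !mxE (bigD1_ord j) //= !mxE unlift_none.
under eq_bigr => m _ do rewrite !mxE liftK.
case: unliftP => [r'|] _; case: unliftP => [s'|] _;
  rewrite ?mxE ?mul0r ?mulr0 ?add0r ?addr0 //.
- by rewrite big1 // => m _; rewrite mulr0.
- by rewrite big1 // => m _; rewrite mul0r.
- by rewrite big1 ?addr0 // => m _; rewrite mul0r.
Qed.

Lemma ins_mx_unit n (i j : 'I_n.+1) (M : 'M[F]_n) c :
  ins_mx i j M c \in unitmx -> M \in unitmx.
Proof.
rewrite !unitmxE (expand_det_row _ i) (bigD1_ord j) //= big1 => [|m _]; last first.
  by rewrite mxE unlift_none liftK mul0r.
rewrite /cofactor addr0 !unitrM => /and3P[_ _].
rewrite (_ : row' i _ = M) //.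
by apply/matrixP=> k l; rewrite !mxE !liftK.
Qed.

Definition uppertri n (M : 'M[F]_n) := forall i j : 'I_n, (j < i)%N -> M i j = 0.
Definition unituppertri n (M : 'M[F]_n) :=
  forall i j : 'I_n, (j <= i)%N -> M i j = (i == j)%:R.

Lemma uppertriM n (A B : 'M[F]_n) : uppertri A -> uppertri B -> uppertri (A *m B).
Proof.
move=> HA HB i j ji; rewrite mxE big1 // => k _.
have [ki|ik] := ltnP k i; first by rewrite HA ?mul0r.
by rewrite HB ?mulr0 // (leq_trans ji).
Qed.

Lemma unituppertriM n (A B : 'M[F]_n) :
  unituppertri A -> unituppertri B -> unituppertri (A *m B).
Proof.
move=> HA HB i j ji; rewrite mxE (bigD1 i) //= HA // eqxx mul1r HB //.
rewrite big1 ?addr0 // => k ki.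
have [ltki|leik] := leqP k i; first by rewrite HA // eq_sym (negPf ki) mul0r.
rewrite HB ?(leq_trans ji) ?(ltnW leik) //.
by rewrite -val_eqE gtn_eqF ?mulr0 // (leq_ltn_trans ji).
Qed.

Lemma leq_lift n (i : 'I_n.+1) (k l : 'I_n) : (lift i k <= lift i l)%N = (k <= l)%N.
Proof. by rewrite /= leq_bump2. Qed.

Lemma ins_uppertri n (i : 'I_n.+1) (M : 'M[F]_n) c :
  uppertri M -> uppertri (ins_mx i i M c).
Proof.
move=> HM k l; rewrite mxE.
case: (unliftP i k) => [k' ->|-> ]; case: (unliftP i l) => [l' ->|->] //.
  by rewrite ltnNge leq_lift -ltnNge; apply: HM.
by rewrite ltnn.
Qed.

Lemma ins_unituppertri n (i : 'I_n.+1) (M : 'M[F]_n) :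
  unituppertri M -> unituppertri (ins_mx i i M 1).
Proof.
move=> HM k l; rewrite mxE.
case: (unliftP i k) => [k' ->|-> ]; case: (unliftP i l) => [l' ->|->] //.
- by rewrite leq_lift => /HM ->; rewrite (inj_eq lift_inj).
- by rewrite eq_sym (negPf (neq_lift _ _)).
- by rewrite (negPf (neq_lift _ _)).
- by rewrite eqxx.
Qed.

Lemma ins_perm n (i j : 'I_n.+1) (s : 'S_n) :
  ins_mx i j (perm_mx s) 1 = perm_mx (lift_perm i j s).
Proof.
apply/matrixP=> k l; rewrite !mxE.
case: (unliftP i k) => [k' ->|-> ]; rewrite ?lift_perm_lift ?lift_perm_id;
  case: (unliftP j l) => [l' ->|->].
- by rewrite !mxE (inj_eq lift_inj).
- by rewrite eq_sym (negPf (neq_lift _ _)).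
- by rewrite (negPf (neq_lift _ _)).
- by rewrite eqxx.
Qed.

(** The pivot is the lowest nonzero entry of the first column: clearing the
column above it uses an upper unitriangular factor on the left, clearing its
row an upper triangular factor on the right. *)
Lemma pivot_mx n (A : 'M[F]_n.+1) : A \in unitmx ->
  exists i (u v : 'M[F]_n.+1) (c : F) (M : 'M[F]_n),
    [/\ A = u *m ins_mx i 0 M c *m v, unituppertri u & uppertri v].
Proof.
move=> Au.
have [i Ai0 maxi] : exists2 i, A i 0 != 0 & forall k : 'I_n.+1, (i < k)%N -> A k 0 = 0.
  have /existsP[i0 Hi0] : [exists i, A i 0 != 0].
    apply: contraLR Au; rewrite negb_exists => /forallP H.
    rewrite unitmxE (expand_det_col _ 0) big1 ?unitr0 // => i _.
    by move: (H i); rewrite negbK => /eqP->; rewrite mul0r.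
  have [i Hi maxi] := @arg_maxnP _ i0 (fun i => A i 0 != 0) (@nat_of_ord _) Hi0.
  exists i => // k ik; apply/eqP; apply: contraTT ik => /maxi.
  by rewrite -leqNgt.
pose c := A i 0.
pose u : 'M[F]_n.+1 := \matrix_(k, l) ((k == l)%:R + ((l == i) && (k != i))%:R * (A k 0 / c)).
pose v : 'M[F]_n.+1 := \matrix_(k, l) ((k == l)%:R + ((k == 0) && (l != 0))%:R * (A i l / c)).
pose M : 'M[F]_n := \matrix_(k, l) (A (lift i k) (lift 0 l) - A (lift i k) 0 * A i (lift 0 l) / c).
exists i, u, v, c, M; split.
- pose N := ins_mx i 0 M c.
  have uN r s : (u *m N) r s = N r s + ((r != i) && (s == 0))%:R * A r 0.
    rewrite mxE (bigD1_ord i) //=.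
    under eq_bigr => m _ do rewrite mxE [lift i m == i]eq_sym (negPf (neq_lift _ _)) mul0r addr0.
    rewrite !mxE unlift_none eqxx.
    case: (unliftP i r) => [r' ->|-> ]; last first.
      rewrite eqxx /= !mul0r !addr0 mul1r big1 ?addr0 // => m _.
      by rewrite (negPf (neq_lift _ _)) mul0r.
    rewrite eq_sym (negPf (neq_lift _ _)) /= add0r mul1r addrC.
    rewrite (bigD1 r') //= eqxx mul1r big1 ?addr0; last first.
      by move=> m mr; rewrite (inj_eq lift_inj) eq_sym (negPf mr) mul0r.
    rewrite mxE liftK; congr (_ + _); case: (unliftP 0 s) => [s' ->|->].
      by rewrite eq_sym (negPf (neq_lift _ _)) mulr0 mul0r.
    by rewrite eqxx mul1r mulfVK.
  apply/matrixP=> r s; rewrite mxE (bigD1_ord 0) //=.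
  under eq_bigr => m _ do
    rewrite uN [v _ _]mxE [lift 0 m == 0]eq_sym (negPf (neq_lift _ _)) andbF !mul0r !addr0.
  rewrite uN [v _ _]mxE eqxx andbT.
  case: (unliftP 0 s) => [s' ->|->]; last first.
    rewrite !eqxx /= mul0r addr0 mulr1 big1 ?addr0; last first.
      by move=> m _; rewrite mulr0.
    rewrite mxE unlift_none; case: (unliftP i r) => [r' ->|-> ].
      by rewrite eq_sym (negPf (neq_lift _ _)) mul1r add0r.
    by rewrite eqxx mul0r addr0.
  rewrite [lift 0 s' == 0]eq_sym !(negPf (neq_lift _ _)) /= add0r mul1r.
  rewrite (bigD1 s') //= eqxx mulr1 big1 ?addr0; last first.
    by move=> m mr; rewrite (inj_eq lift_inj) (negPf mr) mulr0.
  rewrite !mxE unlift_none liftK.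
  case: (unliftP i r) => [r' ->|-> ].
    by rewrite [_ == i]eq_sym (negPf (neq_lift _ _)) mul1r add0r mxE mulrA addrC subrK.
  by rewrite eqxx mul0r !addr0 mulrC mulfVK.
- move=> k l lk; rewrite mxE; have [li|_] := eqVneq l i; last by rewrite mul0r addr0.
  have [ki|ki] := eqVneq k i; first by rewrite mul0r addr0.
  rewrite maxi ?mul0r ?mulr0 ?addr0 // ltn_neqAle -li lk andbT.
  by rewrite val_eqE li eq_sym.
- move=> k l lk; rewrite mxE; have [k0|_] := eqVneq k 0; first by rewrite k0 in lk.
  by rewrite mul0r addr0 -val_eqE gtn_eqF.
Qed.

(** Induction on the size by pivot_mx: inserting the pivot row and column
turns the decomposition of the smaller matrix into one of A, because the
insertion preserves upper triangular and permutation matrices. *)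
Lemma bruhat_mx n (A : 'M[F]_n) : A \in unitmx ->
  exists (u b : 'M[F]_n) (s : 'S_n),
    [/\ A = u *m perm_mx s *m b, unituppertri u & uppertri b].
Proof.
elim: n A => [|n IHn] A Au.
  exists 1%:M, 1%:M, 1%g; split=> [||i]; try by case.
  by apply/matrixP; case.
have [i [u [v [c [M [defA uU vU]]]]]] := pivot_mx Au.
have Mu : M \in unitmx.
  by move: Au; rewrite defA !unitmx_mul => /andP[/andP[_ /ins_mx_unit]].
have [u' [b' [s [defM u'U b'U]]]] := IHn M Mu.
exists (u *m ins_mx i i u' 1), (ins_mx 0 0 b' c *m v), (lift_perm i 0 s); split.
- have eM : ins_mx i 0 M c =
      ins_mx i i u' 1 *m ins_mx i 0 (perm_mx s) 1 *m ins_mx 0 0 b' c.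
    by rewrite !ins_mxM !mul1r -defM.
  by rewrite defA eM ins_perm !mulmxA.
- by apply: unituppertriM => //; apply: ins_unituppertri.
- by apply: uppertriM => //; apply: ins_uppertri.
Qed.

End BruhatMatrix.

Section Bruhat.
Variables (n : nat) (F : finFieldType).
Local Notation N := n.-1.+1.
Local Notation GL := {'GL_n[F]}.
Local Notation w := (perm_GL F).
Local Notation U := (@unitri n F 1%g).

Lemma bruhat (g : GL) : exists u s b,
  [/\ u \in U, b \in borel n F & g = (u * w s * b)%g].
Proof.
have [u [b [s [defg uU bU]]]] := bruhat_mx (GL_unitmx g).
have := GL_unitmx g; rewrite [val _]defg !unitmx_mul => /andP[/andP[u1 _] b1].
exists (Sub u u1), s, (Sub b b1); split; last exact: val_inj.
- apply/unitriP=> i j; rewrite !perm1 -leqNgt; exact: uU.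
- by apply/borelP => i j; exact: bU.
Qed.

(** The sum of the values of s is the sum of the indices, so all the
inequalities are equalities. *)
Lemma perm_ge_id m (s : 'S_m) : (forall i : 'I_m, (i <= s i)%N) -> s = 1%g.
Proof.
move=> le_s; apply/permP=> i; rewrite perm1; apply/val_inj/eqP.
have : (\sum_i (s i : nat) == \sum_(i < m) (i : nat))%N.
  by rewrite [X in _ == X](reindex_inj (@perm_inj _ s)).
rewrite eq_sym (leqif_sum (fun i _ => leqif_eq (le_s i))).2.
by move/forallP/(_ i); rewrite eq_sym.
Qed.

(** Compare entries of w s b^-1 = a w t: the entry (i, s i) is a diagonal entry
of b^-1, so it is nonzero, and a being upper triangular forces i <= t^-1 (s i)
for each i. *)
Lemma bruhat_uniq (s t : 'S_N) (a b : GL) : a \in borel n F -> b \in borel n F ->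
  w s = (a * w t * b)%g -> s = t.
Proof.
move=> aB bB e.
have e' : (w s * b^-1)%g = (a * w t)%g by rewrite e mulgK.
have b'B := borelV bB.
suff H : (s * t^-1 = 1)%g by rewrite -[s](mulgKV t) H mul1g.
apply: perm_ge_id => i; rewrite permM leqNgt; apply/negP=> lti.
have : GLval (w s * b^-1)%g i (s i) != 0.
  by rewrite perm_mulE; exact: borel_diag_neq0.
by rewrite e' mul_permE (borelP _ aB) ?eqxx.
Qed.

End Bruhat.

(** * Overgroups of the Borel subgroup and their index *)
Section PermMeasure.
Variable N : nat.
Implicit Types (s : 'S_N) (i j : 'I_N).

(** A substitute for the number of inversions: it decreases when a
transposition creates an inversion, and comparing two weights involves two terms
only. *)
Definition perm_weight s := (\sum_(k < N) k * s k)%N.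

Lemma perm_weight_tperm s i j : (i < j)%N -> (s j < s i)%N ->
  (perm_weight s < perm_weight (tperm i j * s)%g)%N.
Proof.
move=> ij ji; have ji' : j != i by rewrite -val_eqE gtn_eqF.
rewrite /perm_weight (bigD1 i) //= (bigD1 j) //= [X in (_ < X)%N](bigD1 i) //=.
rewrite [X in (_ < _ + X)%N](bigD1 j) //= !addnA !permM tpermL tpermR.
rewrite [X in (_ < _ + X)%N](eq_bigr (fun k : 'I_N => k * s k)%N); last first.
  by move=> k /andP[ki kj]; rewrite permM tpermD // eq_sym.
rewrite ltn_add2r; nia.
Qed.

Lemma perm_increasing1 s : (forall i j, j = i.+1 :> nat -> (s i < s j)%N) -> s = 1%g.
Proof.
move=> inc; apply: perm_ge_id => -[m]; elim: m => // m IHm ltmN.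
exact: leq_ltn_trans (IHm (ltnW ltmN)) (inc (Ordinal (ltnW ltmN)) (Ordinal ltmN) _).
Qed.
End PermMeasure.

Section Elementary.
Variables (n : nat) (F : finFieldType).
Local Notation N := n.-1.+1.
Local Notation GL := {'GL_n[F]}.
Local Notation w := (perm_GL F).
Implicit Types (s : 'S_N) (g : GL) (i j k l : 'I_N) (c : F).

Definition elem i j c : GL :=
  odflt (1%g : GL) (insub (1%:M + c *: delta_mx i j : 'M[F]_N)).

Lemma elemE i j c k l : i != j ->
  GLval (elem i j c) k l = (k == l)%:R + c * ((k == i) && (l == j))%:R.
Proof.
move=> ij; rewrite /elem insubT /=; last by rewrite !mxE.
have [s sij] : exists s : 'S_N, (s i < s j)%N.
  have [lt|lt|/val_inj e] := ltngtP i j; last by rewrite e eqxx in ij.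
    by exists 1%g; rewrite !perm1.
  by exists (w0 n); rewrite lt_w0.
apply: (@unitri_mx_unit _ _ s) => k' l' nlt; rewrite !mxE.
have [/andP[/eqP ek /eqP el]|_] := boolP ((k' == i) && (l' == j)).
  by rewrite ek el sij in nlt.
by rewrite mulr0 addr0.
Qed.

Lemma elem_unitri s i j c : (s i < s j)%N -> elem i j c \in unitri F s.
Proof.
move=> sij; have ij : i != j by apply: contraTneq sij => ->; rewrite ltnn.
apply/unitriP=> k l nlt; rewrite elemE //.
have [/andP[/eqP ek /eqP el]|_] := boolP ((k == i) && (l == j)).
  by rewrite ek el sij in nlt.
by rewrite mulr0 addr0.
Qed.

Lemma mul_elemE g i j c k l : i != j ->
  GLval (g * elem i j c)%g k l = GLval g k l + (l == j)%:R * (GLval g k i * c).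
Proof.
move=> ij; rewrite GL_mulE.
under eq_bigr => m _ do rewrite elemE // mulrDr.
rewrite big_split /= (bigD1 l) //= eqxx mulr1 big1 ?addr0; last first.
  by move=> m ml; rewrite (negPf ml) mulr0.
congr (_ + _); rewrite (bigD1 i) //= eqxx big1 ?addr0 => [|m mi].
  by rewrite [RHS]mulrC mulrA.
by rewrite (negPf mi) !mulr0.
Qed.

Lemma elemJ s i j c : i != j ->
  (w s * elem (s i) (s j) c * (w s)^-1)%g = elem i j c.
Proof.
move=> ij; apply/val_inj/matrixP=> k l.
rewrite [LHS]permJE [RHS]elemE // !elemE ?(inj_eq perm_inj) //.
Qed.

(** In the 2 x 2 block of rows and columns i, j this is the identity
[0 1; 1 0] [1 1; 0 1] [1 0; -1 1] = [-1 1; 0 1]. *)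
Lemma tperm_factor i j : (i < j)%N ->
  (w (tperm i j) * elem i j 1%R * elem j i (- 1)%R)%g \in borel n F.
Proof.
move=> ij; have ij' : i != j by rewrite -val_eqE ltn_eqF.
have nE k l : GLval (w (tperm i j)) k l = (tperm i j k == l)%:R.
  by rewrite /= !mxE.
have ji' : j != i by rewrite eq_sym.
apply/borelP=> k l lk; rewrite mul_elemE // !mul_elemE // !nE.
rewrite !mulr1 !mulrN1 mulrN eqxx mul1r.
case: tpermP => [ki|kj|/eqP ki /eqP kj]; subst.
- by rewrite (negPf ji') mulr0 !addr0 -val_eqE gtn_eqF ?(ltn_trans lk) // -val_eqE
    ltn_eqF // mul0r oppr0 addr0.
- rewrite (negPf ij') eqxx -[l == j]val_eqE ltn_eqF // mul0r addr0 add0r mulr1.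
  by rewrite [l == i]eq_sym subrr.
- by rewrite (negPf ki) (negPf kj) mulr0 !addr0 mulr0 oppr0 addr0 -val_eqE gtn_eqF.
Qed.

End Elementary.

Section Parabolic.
Variables (n : nat) (F : finFieldType).
Local Notation N := n.-1.+1.
Local Notation GL := {'GL_n[F]}.
Local Notation w := (perm_GL F).
Local Notation U := (@unitri n F 1%g).
Variable P : {group GL}.
Hypothesis BP : borel n F \subset P.
Implicit Types (s x t : 'S_N) (g u v : GL) (i j k l : 'I_N) (c : F).

(** When P contains B this is an equivalence relation whose classes are the
intervals of indices of the Levi blocks of P. *)
Definition linked i j : bool := w (tperm i j) \in P.

Lemma linked_refl i : linked i i.
Proof. by rewrite /linked tperm1 perm_GL1; apply: group1. Qed.

Lemma linked_sym i j : linked i j = linked j i.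
Proof. by rewrite /linked tpermC. Qed.

Lemma weyl_mul s t : w s \in P -> w t \in P -> w (s * t)%g \in P.
Proof. by move=> sP tP; rewrite perm_GLM; apply: group_mul_closed. Qed.

Lemma weyl_inv s : w s \in P -> w s^-1%g \in P.
Proof. by move=> sP; rewrite perm_GLV; apply: group_inv_closed. Qed.

Lemma linked_trans i j k : linked i j -> linked j k -> linked i k.
Proof.
have [-> // | ij] := eqVneq i j; have [-> // | ik] := eqVneq i k.
  by move=> *; apply: linked_refl.
move=> Lij Ljk; rewrite /linked.
have <- : (tperm i j ^ tperm j k)%g = tperm i k.
  by rewrite tpermJ tpermL tpermD // eq_sym.
by rewrite /conjg; apply: weyl_mul; [apply: weyl_inv | apply: weyl_mul].
Qed.

Lemma borel_in g : g \in borel n F -> g \in P.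
Proof. exact: (subsetP BP). Qed.

Lemma unitri_in g : g \in U -> g \in P.
Proof. by move/(subsetP (unitri_sub_borel n F))/borel_in. Qed.

(** Conjugating an upper elementary matrix by w x gives a lower elementary
matrix of P in position (j, i), and tperm_factor then puts the transposition
in P. *)
Lemma linked_inversion x i j :
  w x \in P -> (i < j)%N -> (x j < x i)%N -> linked i j.
Proof.
move=> xP ij xji; have ji' : j != i by rewrite -val_eqE gtn_eqF.
have elow : elem j i (- 1)%R \in P.
  rewrite -(elemJ x) //; apply: group_mul_closed; last exact: group_inv_closed.
  apply: group_mul_closed => //; apply: unitri_in; apply: elem_unitri.
  by rewrite !perm1.
have eup : elem i j 1%R \in P.
  by apply: unitri_in; apply: elem_unitri; rewrite !perm1.
have := borel_in (tperm_factor F ij).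
move=> /group_mul_closed/(_ (group_inv_closed elow)); rewrite mulgK.
by move=> /group_mul_closed/(_ (group_inv_closed eup)); rewrite mulgK.
Qed.

(** The transposition of i and j has the inversion (i, k). *)
Lemma linked_convex i k j : (i < k)%N -> (k < j)%N -> linked i j -> linked i k.
Proof.
move=> ik kj; move/linked_inversion/(_ ik); rewrite tpermL; apply.
by rewrite tpermD // -val_eqE neq_ltn ?ik ?kj ?orbT.
Qed.

(** The minimal length representatives of the cosets of the Weyl group of P. *)
Definition block_incr s : bool :=
  [forall i : 'I_N, forall j : 'I_N, ((i < j)%N && linked i j) ==> (s i < s j)%N].

Lemma block_incrP s :
  reflect (forall i j, (i < j)%N -> linked i j -> (s i < s j)%N) (block_incr s).
Proof.
apply: (iffP forallP) => [H i j ij Lij | H i].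
  by move/forallP/(_ j)/implyP: (H i); apply; rewrite ij.
by apply/forallP=> j; apply/implyP=> /andP[]; apply: H.
Qed.

(** Maximize perm_weight in the coset: an inversion inside a block could be
removed by a transposition lying in P. *)
Lemma block_incr_rep t : exists2 x, w x \in P & block_incr (x * t)%g.
Proof.
have P1 : w 1%g \in P by rewrite perm_GL1; apply: group1.
have [x xP maxx] := @arg_maxnP _ 1%g (fun x => w x \in P)
  (fun x => perm_weight (x * t)%g) P1.
exists x => //; apply/block_incrP=> i j ij Lij; rewrite ltnNge; apply/negP=> le_ji.
have ltji : ((x * t)%g j < (x * t)%g i)%N.
  by rewrite ltn_neqAle le_ji val_eqE (inj_eq perm_inj) -val_eqE gtn_eqF.
have := perm_weight_tperm ij ltji; rewrite ltnNge mulgA => /negP; apply.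
by apply: maxx; exact: weyl_mul.
Qed.

(** An inversion (i, j) of x is inside a block, and so is the inversion
(x j, x i) of x^-1; s and x * s cannot both increase on these. *)
Lemma block_incr_uniq x s :
  w x \in P -> block_incr s -> block_incr (x * s)%g -> x = 1%g.
Proof.
move=> xP /block_incrP sI /block_incrP xsI; apply: perm_increasing1 => i j ij1.
have ij : (i < j)%N by rewrite ij1.
rewrite ltnNge; apply/negP=> le_ji.
have ltji : (x j < x i)%N.
  by rewrite ltn_neqAle le_ji val_eqE (inj_eq perm_inj) -val_eqE gtn_eqF.
have := xsI i j ij (linked_inversion xP ij ltji); rewrite !permM ltnNge ltnW //.
apply: sI => //; apply: (linked_inversion (weyl_inv xP) ltji).
by rewrite !permK.
Qed.

(** In the Bruhat decomposition of g the unipotent factor may be taken in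
U and in the subgroup opposite to w x^-1 U w x; its nonzero entries then sit at
inversions of a Weyl element of P, hence inside the blocks of P. *)
Lemma parabolic_bruhat g : g \in P -> exists b x v,
  [/\ b \in borel n F, w x \in P, v \in U, g = (b * w x * v)%g
    & forall s, block_incr s -> v \in unitri F s].
Proof.
move=> gP; have [u [t [b [uU bB eg]]]] := bruhat g^-1%g.
have eg' : g = (b^-1 * w t^-1 * u^-1)%g by rewrite perm_GLV -[g]invgK eg !invMg mulgA.
have := unitriV uU; rewrite {1}(unitri_decomp F 1%g t).
case/mulsgP=> a v /setIP[aU aUt] /setIP[vU vUt] eu.
have xP : w t^-1%g \in P.
  have -> : w t^-1%g = (b * g * u)%g by rewrite eg' !mulgA mulgV mul1g mulgKV.
  by rewrite !group_mul_closed ?gP ?(borel_in bB) ?(unitri_in uU).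
pose a' := (w t^-1 * a * (w t^-1)^-1)%g.
have a'U : a' \in U by rewrite -(mulVg t) unitriJ.
exists (b^-1 * a')%g, t^-1%g, v; split=> //.
- by apply: borelM; [apply: borelV | apply: (subsetP (unitri_sub_borel n F))].
- by rewrite eg' eu /a' !mulgA mulgKV.
move=> s /block_incrP sI; apply/unitriP=> i j nlt.
have [-> |ij] := eqVneq i j; first exact: (unitri_diag _ vU).
apply/eqP; apply: contraNT nlt => nz.
have := unitri_neq0 vU ij nz; rewrite !perm1 => ltij.
apply: sI => //; apply: (linked_inversion (weyl_inv xP) ltij).
by rewrite invgK -lt_mulw0; apply: unitri_neq0 nz.
Qed.

(** The factor v of p passes through w s by block_incr s, so that
w s' lies in B w (x * s) B with w x in P; uniqueness in the Bruhat decomposition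
and of block-increasing representatives concludes. *)
Lemma parabolic_cell_inj s s' p u :
  block_incr s -> block_incr s' -> p \in P -> u \in U ->
  w s' = (p * w s * u)%g -> s' = s.
Proof.
move=> sI s'I /parabolic_bruhat[b [x [v [bB xP vU ep vI]]]] uU e.
pose v' := ((w s)^-1 * v * w s)%g.
have v'U : v' \in U.
  by rewrite unitriJV; exact: vI.
have es' : s' = (x * s)%g.
  apply: (@bruhat_uniq _ F _ _ b (v' * u)%g) => //.
    by apply: (subsetP (unitri_sub_borel n F)); apply: unitriM.
  by rewrite e ep /v' perm_GLM !mulgA mulgK.
by rewrite es' (block_incr_uniq xP sI) ?mul1g // -es'.
Qed.

(** P meets w s U (w s)^-1 only in upper triangular matrices: the lower root
subgroups of P are inside the blocks, where s is increasing. *)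
Lemma parabolic_cap_unitri s : block_incr s ->
  P :&: unitri F s = U :&: unitri F s.
Proof.
move=> sI; apply/eqP; rewrite eqEsubset; apply/andP; split; last first.
  by rewrite setSI //; apply/subsetP=> u; exact: unitri_in.
apply/subsetP=> p /setIP[pP ps]; rewrite inE ps andbT.
have [b [x [v [bB xP vU ep /(_ s sI) vs]]]] := parabolic_bruhat pP.
pose u' := ((w s)^-1 * (p * v^-1) * w s)%g.
have u'U : u' \in U.
  by rewrite unitriJV; apply: unitriM => //; apply: unitriV.
have es : s = (x * s)%g.
  apply: (@bruhat_uniq _ F _ _ b u'^-1%g) => //.
    by apply: (subsetP (unitri_sub_borel n F)); apply: unitriV.
  apply: (mulIg u'); rewrite mulgKV perm_GLM /u' ep.
  by rewrite !mulgA mulgV mul1g mulgK.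
have x1 : x = 1%g by apply: (mulIg s); rewrite mul1g -es.
have eb : b = (p * v^-1)%g by rewrite ep x1 perm_GL1 mulg1 mulgK.
rewrite -[p](mulgKV v) -eb; apply: unitriM => //.
apply: (subsetP (unitri_cap_borel F s)); rewrite inE bB andbT eb.
by apply: unitriM => //; apply: unitriV.
Qed.

(** The double coset P (w s) U. *)
Definition cell s : {set GL} := ((P * unitri F s) :* w s)%g.

Lemma cellP s g :
  reflect (exists p u, [/\ p \in P, u \in U & g = (p * w s * u)%g]) (g \in cell s).
Proof.
apply: (iffP idP) => [/rcosetP[_ /mulsgP[p u pP us ->] ->] | [p [u [pP uU ->]]]].
  exists p, ((w s)^-1 * u * w s)%g; split; rewrite ?unitriJV //.
  by rewrite !mulgA mulgK.
apply/rcosetP; exists (p * (w s * u * (w s)^-1))%g; last by rewrite !mulgA mulgKV.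
by apply: mem_mulg => //; have := unitriJ s 1%g u; rewrite mulg1 => ->.
Qed.

Lemma card_unitri s : #|unitri F s| = #|U|.
Proof.
have inj : injective (fun g : GL => (w s * g * (w s)^-1)%g).
  by move=> g h /mulIg/mulgI.
rewrite -(card_imset U inj); congr #|pred_of_set _|; apply/setP=> g.
apply/idP/imsetP => [gs | [h hU ->]]; last by rewrite -[s in unitri _ s]mulg1 unitriJ.
exists ((w s)^-1 * g * w s)%g; first by rewrite unitriJV.
by rewrite !mulgA mulgV mul1g mulgK.
Qed.

Lemma card_cell s : block_incr s ->
  #|cell s| = (#|P| * #|U :&: unitri F (s * w0 n)%g|)%N.
Proof.
move=> sI; rewrite /cell card_rcoset.
have posI : (0 < #|U :&: unitri F s|)%N.
  exact: (cardG_gt0 (unitri_group F 1%g :&: unitri_group F s)%G).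
apply/eqP; rewrite -(eqn_pmul2r posI) -{1}parabolic_cap_unitri //.
have -> := esym (mul_cardG P (unitri_group F s)).
by rewrite card_unitri (card_unitri_decomp F 1%g s) -mulnA [X in (_ * X)%N]mulnC.
Qed.

Lemma cell_cover g : exists2 s, block_incr s & g \in cell s.
Proof.
have [u [t [b [uU bB eg]]]] := bruhat g^-1%g.
have [x xP sI] := block_incr_rep t^-1%g; exists (x * t^-1)%g => //.
apply/cellP; exists (b^-1 * (w x)^-1)%g, u^-1%g; split.
- apply: group_mul_closed; last exact: group_inv_closed.
  by apply: borel_in; apply: borelV.
- exact: unitriV.
by rewrite perm_GLM !mulgA mulgKV perm_GLV -[g]invgK eg !invMg mulgA.
Qed.

Lemma cell_inj s s' g : block_incr s -> block_incr s' ->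
  g \in cell s -> g \in cell s' -> s = s'.
Proof.
move=> sI s'I /cellP[p [u [pP uU ->]]] /cellP[p' [u' [p'P u'U e]]].
apply: (@parabolic_cell_inj s' s (p^-1 * p')%g (u' * u^-1)%g) => //.
- by apply: group_mul_closed => //; apply: group_inv_closed.
- by apply: unitriM => //; apply: unitriV.
exact: mulg_isolate_middle.
Qed.

(** G is the disjoint union of the cells P (w s) U over the block-increasing s,
and such a cell has |P| |U| / |U :&: unitri s| elements. *)
Lemma index_parabolic :
  #|'GL_n[F] : P|%g = (\sum_(s | block_incr s) #|U :&: unitri F (s * w0 n)%g|)%N.
Proof.
apply/eqP; rewrite -(eqn_pmul2l (cardG_gt0 P)) Lagrange ?subsetT //.
rewrite big_distrr /= -(eq_bigr _ (fun s sI => card_cell sI)).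
rewrite cardsT -sum1_card.
under [X in _ == X]eq_bigr => s _ do rewrite -sum1_card big_mkcond /=.
rewrite exchange_big /=; apply/eqP/eq_bigr => g _.
have [s sI gs] := cell_cover g.
rewrite (bigD1 s) //= gs big1 // => s' /andP[s'I ss'].
by case: ifP => // gs'; rewrite (cell_inj sI s'I gs gs') eqxx in ss'.
Qed.

End Parabolic.

(** * The group ring and the panel relations of the Steinberg ideal *)
Section GroupRingTheory.
Variables (R : comPzRingType) (gT : finGroupType).
Local Notation AG := (group_ring R gT).
Implicit Types (x y z : AG) (r s : R) (g h : gT).

Lemma grME x y g : (x * y) g = \sum_h x h * y (h^-1 * g)%g.
Proof. exact: gr_mulE. Qed.

Lemma gr_oppE x g : (- x) g = - x g.
Proof. by rewrite ffunE. Qed.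

Lemma gr_zeroE g : (0 : AG) g = 0.
Proof. by rewrite ffunE. Qed.

Lemma gr_mulrnE x m g : (x *+ m) g = x g *+ m.
Proof. by rewrite ffunMnE. Qed.

Lemma gr_sumE I (P : pred I) (e : seq I) (f : I -> AG) g :
  (\sum_(i <- e | P i) f i) g = \sum_(i <- e | P i) f i g.
Proof. by rewrite sum_ffunE. Qed.

Lemma gr_eltM h x g : (gr_elt R h * x) g = x (h^-1 * g)%g.
Proof.
rewrite grME (bigD1 h) //= gr_eltE eqxx mul1r big1 ?addr0 // => k kh.
by rewrite gr_eltE (negPf kh) mul0r.
Qed.

(** The copy of R in the centre of the group ring. *)
Definition gr_scalar r : AG := [ffun g => r * (g == 1%g)%:R].

Lemma gr_scalarM r x g : (gr_scalar r * x) g = r * x g.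
Proof.
rewrite grME (bigD1 1%g) //= ffunE eqxx mulr1 invg1 mul1g big1 ?addr0 // => k k1.
by rewrite ffunE (negPf k1) mulr0 mul0r.
Qed.

Lemma gr_scalarC r x : x * gr_scalar r = gr_scalar r * x.
Proof.
apply: gr_ext => g; rewrite gr_scalarM grME (bigD1 g) //= ffunE mulVg eqxx mulr1.
rewrite mulrC big1 ?addr0 // => k kg.
by rewrite ffunE -eq_mulVg1 (negPf kg) !mulr0.
Qed.

Lemma gr_scalarMM r s : gr_scalar r * gr_scalar s = gr_scalar (r * s).
Proof. by apply: gr_ext => g; rewrite gr_scalarM !ffunE mulrA. Qed.

Lemma gr_scalar_nat x m : gr_scalar m%:R * x = x *+ m.
Proof. by apply: gr_ext => g; rewrite gr_scalarM gr_mulrnE mulr_natl. Qed.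

Lemma gr_scalarCA r x y : x * (gr_scalar r * y) = gr_scalar r * (x * y).
Proof. by rewrite !mulrA gr_scalarC. Qed.

Lemma gr_sumSE (A : {set gT}) g : gr_sum R A g = (g \in A)%:R.
Proof.
rewrite /gr_sum gr_sumE; have [gA|gA] := boolP (g \in A).
  rewrite (bigD1 g) //= gr_eltE eqxx big1 ?addr0 // => h /andP[_ hg].
  by rewrite gr_eltE eq_sym (negPf hg).
rewrite big1 // => h hA; rewrite gr_eltE.
by case: eqP => // e; rewrite e hA in gA.
Qed.

Lemma gr_signM (b : bool) x g : ((-1) ^+ b * x) g = (-1) ^+ b * x g.
Proof. by case: b; rewrite ?expr1 ?expr0 ?mul1r // !mulN1r gr_oppE. Qed.

Lemma grM_inv (a b : AG) g :
  (a * b) g^-1%g = \sum_h b h^-1%g * a (h^-1 * g)^-1%g.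
Proof.
rewrite grME (reindex_inj (@mulgI _ g^-1%g)) /=; apply: eq_bigr => h _.
by rewrite mulrC !invMg !invgK mulgK.
Qed.

(** The anti-involution that inverts group elements; it is gr_adj in the case of
the general linear group, and the adjoint for the form. *)
Definition gr_anti (a : AG) : AG := [ffun g => a g^-1%g].

Lemma gr_antiE a g : gr_anti a g = a g^-1%g. Proof. by rewrite ffunE. Qed.

Lemma gr_antiM a b : gr_anti (a * b) = gr_anti b * gr_anti a.
Proof.
apply: gr_ext => g; rewrite gr_antiE grM_inv grME.
by apply: eq_bigr => h _; rewrite !gr_antiE.
Qed.

Lemma gr_antiK a : gr_anti (gr_anti a) = a.
Proof. by apply: gr_ext => g; rewrite !gr_antiE invgK. Qed.

Lemma gr_anti_elt g : gr_anti (gr_elt R g) = gr_elt R g^-1%g.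
Proof. by apply: gr_ext => h; rewrite gr_antiE !gr_eltE (can2_eq invgK invgK). Qed.
End GroupRingTheory.

Arguments gr_scalar {R gT} r.

Section Adjoint.
Variables (n : nat) (F : finFieldType) (R : idomainType).
Local Notation GL := {'GL_n[F]}.
Local Notation RG := (group_ring R GL).
Local Notation adj := (@gr_adj n F R).
Implicit Types (x y a b : RG) (g : GL).

Lemma gr_adj_anti a : adj a = gr_anti a. Proof. by []. Qed.
End Adjoint.

Section SteinbergElt.
Variables (n : nat) (F : finFieldType) (R : idomainType).
Hypothesis charR : [pchar R] =i pred0.
Local Notation N := n.-1.+1.
Local Notation GL := {'GL_n[F]}.
Local Notation RG := (group_ring R GL).
Local Notation w := (@perm_GL n F).
Local Notation U := (@unitri n F 1%g).
Local Notation B := (borel n F).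
Local Notation eps := (steinberg_elt n F R).
Local Notation I := (@steinberg_ideal n F R).
Implicit Types (x y a : RG) (s t : 'S_N) (g h u v b : GL) (i j k l : 'I_N).

Lemma steinberg_eltE g :
  eps g = \sum_(s : 'S_N) (-1) ^+ (s : bool) * ((w s)^-1 * g \in B)%g%:R.
Proof.
rewrite gr_sumE; apply: eq_bigr => s _.
by rewrite -mulrA gr_signM gr_eltM gr_sumSE.
Qed.

Lemma steinberg_elt_borel g b : b \in B -> eps (g * b)%g = eps g.
Proof.
move=> bB; rewrite !steinberg_eltE; apply: eq_bigr => s _; congr (_ * _%:R).
rewrite mulgA; congr (nat_of_bool _); apply/idP/idP => H; last exact: borelM.
by rewrite -[X in X \in _](mulgK b); apply: borelM => //; apply: borelV.
Qed.

Lemma steinberg_idealP x : reflect (exists a, x = a * eps) (x \in I).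
Proof. exact: asboolP. Qed.

Lemma steinberg_ideal_borel x g b : x \in I -> b \in B -> x (g * b)%g = x g.
Proof.
move=> /steinberg_idealP[a ->] bB; rewrite !grME; apply: eq_bigr => h _.
by rewrite mulgA steinberg_elt_borel.
Qed.

Lemma steinberg_idealM a x : x \in I -> a * x \in I.
Proof.
move/steinberg_idealP=> [a' ->]; apply/steinberg_idealP.
by exists (a * a'); rewrite mulrA.
Qed.

Lemma steinberg_idealB x y : x \in I -> y \in I -> x - y \in I.
Proof.
move=> /steinberg_idealP[a ->] /steinberg_idealP[a' ->]; apply/steinberg_idealP.
by exists (a - a'); rewrite mulrBl.
Qed.

Lemma steinberg_elt_in : eps \in I.
Proof. by apply/steinberg_idealP; exists 1; rewrite mul1r. Qed.

Section Panel.
Variables (i j : 'I_N).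
Hypothesis ij1 : j = i.+1 :> nat.

(** The vanishing conditions that define the minimal parabolic subgroup of
i and j. *)
Definition near_borel g : bool :=
  [forall k : 'I_N, forall l : 'I_N,
     ((l < k)%N && ((k != j) || (l != i))) ==> (GLval g k l == 0)].

Lemma near_borelP g :
  reflect (forall k l, (l < k)%N -> (k != j) || (l != i) -> GLval g k l = 0)
          (near_borel g).
Proof.
apply: (iffP forallP) => [H k l lk kl | H k].
  by move/forallP/(_ l)/implyP: (H k); rewrite lk kl => /(_ isT)/eqP.
by apply/forallP=> l; apply/implyP=> /andP[lk kl]; apply/eqP/H.
Qed.

Lemma borel_near g : (g \in B) = near_borel g && (GLval g j i == 0).
Proof.
apply/borelP/andP => [gB | [/near_borelP nb /eqP gji] k l lk].
  by split; [apply/near_borelP=> k l lk _; exact: gB | rewrite gB // ij1].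
by have [/nb-> //|] := boolP ((k != j) || (l != i));
  rewrite negb_or !negbK => /andP[/eqP-> /eqP->].
Qed.

Lemma near_borel_perm g : near_borel (w (tperm i j) * g)%g = near_borel g.
Proof.
have ij : (i < j)%N by rewrite ij1.
have half h : near_borel h -> near_borel (w (tperm i j) * h)%g.
  move/near_borelP=> nb; apply/near_borelP=> k l lk kl; rewrite perm_mulE.
  case: tpermP kl => [ki|kj|/eqP ki /eqP kj] kl; last exact: nb.
    subst k; apply: nb; first exact: ltn_trans lk ij.
    by rewrite orbC -val_eqE ltn_eqF.
  subst k; rewrite eqxx /= in kl; apply: nb; last by rewrite kl orbT.
  by move: lk kl; rewrite ij1 ltnS leq_eqVlt val_eqE => /predU1P[->|//]; rewrite eqxx.
apply/idP/idP => [/half|/half//].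
by rewrite mulgA -perm_GLM tperm2 perm_GL1 mul1g.
Qed.

Lemma borel_panel g c :
  (g * elem i j c * w (tperm i j) \in B)%g =
  near_borel g && (GLval g j j + c * GLval g j i == 0).
Proof.
have ij0 : (i < j)%N by rewrite ij1.
have ij : i != j by rewrite -val_eqE ltn_eqF.
have E k l : GLval (g * elem i j c * w (tperm i j))%g k l =
  if l == i then GLval g k j + c * GLval g k i else
  if l == j then GLval g k i else GLval g k l.
  rewrite mul_permE tpermV mul_elemE //; case: tpermP => [->|->|/eqP li /eqP lj].
  - by rewrite !eqxx mul1r mulrC.
  - by rewrite [j == i]eq_sym (negPf ij) eqxx mul0r addr0.
  by rewrite (negPf li) (negPf lj) mul0r addr0.
apply/borelP/andP => [gB | [/near_borelP nb /eqP gjj] k l lk]; last first.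
  rewrite E; case: eqP lk => [->|/eqP li] lk.
    have [->//|kj] := eqVneq k j.
    rewrite !nb ?kj //; first by rewrite mulr0 addr0.
    by rewrite ltn_neqAle eq_sym val_eqE kj /= ij1.
  case: eqP lk => [->|/eqP lj] lk; last by rewrite nb ?li ?orbT.
  rewrite nb //; first by apply: ltn_trans lk; rewrite ij1.
  by rewrite -val_eqE gtn_eqF.
have gki k : (j < k)%N -> GLval g k i = 0.
  by move=> /gB; rewrite E eq_sym (negPf ij) eqxx.
split; last by have := gB j i; rewrite E eqxx ij1 => ->.
apply/near_borelP=> k l lk kl.
have [li|li] := eqVneq l i.
  subst l; rewrite eqxx orbF in kl; apply: gki.
  by rewrite ltn_neqAle eq_sym val_eqE kl ij1.
have [lj|lj] := eqVneq l j.
  subst l; have := gB k i; rewrite E eqxx gki // mulr0 addr0; apply.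
  by apply: ltn_trans lk; rewrite ij1.
by have := gB k l lk; rewrite E (negPf li) (negPf lj).
Qed.

(** A panel contained in the minimal parabolic subgroup has exactly one chamber
equal to B, and any other panel has none. *)
Lemma panel_count g :
  (g \in B)%:R + \sum_c (g * elem i j c * w (tperm i j) \in B)%g%:R =
  (near_borel g)%:R :> R.
Proof.
rewrite borel_near; under eq_bigr => c _ do rewrite borel_panel.
have [nb|_] /= := boolP (near_borel g); last by rewrite big1 ?addr0.
have [g0|gN0] /= := eqVneq (GLval g j i) 0.
  rewrite big1 ?addr0 // => c _; rewrite g0 mulr0 addr0.
  by rewrite (negPf (borel_diag_neq0 j _)) // borel_near nb g0 eqxx.
rewrite add0r (bigD1 (- GLval g j j / GLval g j i)) //= mulfVK // subrr eqxx.
rewrite big1 ?addr0 // => c cN; case: eqP => // e; case/eqP: cN.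
by apply: (mulIf gN0); rewrite mulfVK //; apply/eqP; rewrite -addr_eq0 addrC e.
Qed.

(** The sum over a panel is an alternating sum of near_borel ((w s)^-1 * g), which
is invariant under s -> s * tperm i j; so it is equal to its opposite. *)
Lemma steinberg_elt_panel g :
  eps g + \sum_c eps (g * elem i j c * w (tperm i j))%g = 0.
Proof.
under eq_bigr => c _ do rewrite steinberg_eltE.
have ij : i != j by rewrite -val_eqE neq_ltn /= ij1 ltnSn.
rewrite steinberg_eltE exchange_big -big_split /=.
under eq_bigr => s _ do rewrite -mulr_sumr -mulrDr.
under eq_bigr => s _ do under [X in _ * (_ + X)]eq_bigr => c _ do rewrite !mulgA.
under eq_bigr => s _ do rewrite panel_count.
set S := \sum_(s : 'S_N) _.
have SN : S = - S.
  rewrite {1}/S (reindex_inj (mulIg (tperm i j))) /= -sumrN; apply: eq_bigr => s _.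
  rewrite odd_permM odd_tperm ij signr_addb mulrN1 mulNr.
  have tt : (w (tperm i j) * w (tperm i j) = 1)%g by rewrite -perm_GLM tperm2 perm_GL1.
  by rewrite (invol_mulV g (perm_GLM _ _ _) tt) near_borel_perm.
have : S *+ 2 = 0 by rewrite mulr2n {1}SN addNr.
move/eqP; rewrite -mulr_natr mulf_eq0 => /orP[/eqP//|].
by rewrite ((pcharf0P _).1 charR).
Qed.

Lemma steinberg_ideal_panel x g : x \in I ->
  x g + \sum_c x (g * elem i j c * w (tperm i j))%g = 0.
Proof.
move=> /steinberg_idealP[a ->].
under eq_bigr => c _ do rewrite grME.
rewrite grME exchange_big -big_split big1 //= => h _.
rewrite -mulr_sumr -mulrDr.
under eq_bigr => c _ do rewrite !mulgA.
by rewrite steinberg_elt_panel mulr0.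
Qed.
End Panel.

Lemma borel_conjV_unitri s u : u \in U ->
  ((w s)^-1 * (u * w s) \in B)%g = (u \in unitri F s).
Proof.
rewrite mulgA => uU; rewrite -unitriJV.
apply/idP/idP => [/borelP uB|]; last exact: (subsetP (unitri_sub_borel n F)).
rewrite unitriJV; apply/unitriP=> i j; rewrite -leqNgt leq_eqVlt.
case/predU1P=> [/val_inj/perm_inj-> | sji]; first by rewrite (unitri_diag _ uU) eqxx.
have := uB _ _ sji; rewrite permJVE !permK => ->.
by case: eqP sji => // ->; rewrite ltnn.
Qed.

(** By uniqueness in the Bruhat decomposition only the term s of eps can
meet the coset of u * w s. *)
Lemma steinberg_elt_cell u s : u \in U ->
  eps (u * w s)%g = (-1) ^+ (s : bool) * (u \in unitri F s)%:R.
Proof.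
move=> uU; rewrite steinberg_eltE (bigD1 s) //= borel_conjV_unitri //.
rewrite big1 ?addr0 // => t ts; have [bB|] := boolP (_ \in B); last by rewrite mulr0.
case/eqP: ts; apply: (@bruhat_uniq _ F _ _ u ((w t)^-1 * (u * w s))^-1%g).
- by apply: (subsetP (unitri_sub_borel n F)).
- exact: borelV.
- exact: mulg_divK.
Qed.

Lemma steinberg_elt_big_cell u : u \in U ->
  eps (u * w (w0 n))%g = (-1) ^+ (w0 n : bool) * (u == 1%g)%:R.
Proof.
move=> uU; rewrite steinberg_elt_cell //; congr (_ * _%:R).
congr nat_of_bool; apply/idP/eqP => [u0|->]; last exact: group1.
by apply/set1gP; rewrite -(unitri_opp_cap F 1%g) inE uU mul1g.
Qed.

(** If s^-1 has an ascent at (i, j), the panel relation expresses the value of x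
at u * w s by its values on U * w (s * tperm i j); this lowers the weight of s^-1,
and the only permutation without ascent is w0. *)
Lemma steinberg_ideal_big_cell0 x : x \in I ->
  (forall u, u \in U -> x (u * w (w0 n))%g = 0) -> x = 0.
Proof.
move=> xI x0; apply: gr_ext => g; rewrite gr_zeroE.
have [u [s [b [uU bB ->]]]] := bruhat g; rewrite (steinberg_ideal_borel _ xI bB).
have [m] := ubnP (perm_weight s^-1%g); elim: m s u uU => // m IHm s u uU lem.
have [/existsP[i /existsP[j /andP[/eqP ij1 sij]]]|] :=
    boolP [exists i : 'I_N, exists j : 'I_N, (j == i.+1 :> nat) && (s^-1 i < s^-1 j)%g%N].
  have := steinberg_ideal_panel ij1 (u * w s)%g xI.
  rewrite big1 ?addr0 // => c _.
  pose e' := (w s * elem i j c * (w s)^-1)%g.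
  have e'U : e' \in U by rewrite -(mulgV s) unitriJ; apply: elem_unitri.
  have -> : (u * w s * elem i j c * w (tperm i j) = u * e' * w (s * tperm i j))%g.
    by rewrite perm_GLM /e' !mulgA mulgKV.
  apply: IHm; first exact: unitriM.
  rewrite -ltnS (leq_trans _ lem) // ltnS invMg tpermV.
  rewrite -[X in (_ < perm_weight X)%N](mulKg (tperm i j)) tpermV.
  apply: perm_weight_tperm; first by rewrite ij1.
  by rewrite !permM tpermL tpermR.
rewrite negb_exists => /forallP H.
suff -> : s = w0 n by exact: x0.
suff e : (s^-1 * w0 n = 1)%g by rewrite -[w0 n](mulKVg s) e mulg1.
apply: perm_increasing1 => i j ij1; rewrite lt_mulw0 ltn_neqAle val_eqE (inj_eq perm_inj).
rewrite -val_eqE /= ij1 gtn_eqF //= leqNgt.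
by move: (H i); rewrite negb_exists => /forallP/(_ j); rewrite ij1 eqxx.
Qed.

Definition unitri_comb (f : GL -> R) : RG := [ffun u => if u \in U then f u else 0].

Lemma unitri_combM f x g :
  (unitri_comb f * x) g = \sum_(u in U) f u * x (u^-1 * g)%g.
Proof.
rewrite grME [RHS]big_mkcond /=; apply: eq_bigr => u _.
by rewrite ffunE; case: ifP => // _; rewrite mul0r.
Qed.

Lemma unitri_comb_big_cell f v : v \in U ->
  (unitri_comb f * eps) (v * w (w0 n))%g = (-1) ^+ (w0 n : bool) * f v.
Proof.
move=> vU; rewrite unitri_combM (bigD1 v) //= big1 ?addr0 => [|u /andP[uU uv]].
  by rewrite mulKg -[w _]mul1g steinberg_elt_big_cell ?group1 // eqxx mulr1 mulrC.
rewrite mulgA steinberg_elt_big_cell; last by apply: unitriM => //; apply: unitriV.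
by rewrite -eq_mulVg1 (negPf uv) !mulr0.
Qed.

(** Both sides agree on U * w w0, where u eps takes the value sgn w0 at u w0 and
0 elsewhere; so the translates of eps by U span the ideal and the coordinates
are values of x. *)
Lemma steinberg_ideal_unitri x : x \in I ->
  x = unitri_comb (fun u => (-1) ^+ (w0 n : bool) * x (u * w (w0 n))%g) * eps.
Proof.
move=> xI; apply/eqP; rewrite -subr_eq0; apply/eqP.
apply: steinberg_ideal_big_cell0.
  by apply: steinberg_idealB => //; apply/steinberg_idealP; eexists.
move=> u uU; rewrite gr_addE gr_oppE unitri_comb_big_cell //.
by rewrite mulrA -signr_addb addbb mul1r subrr.
Qed.

End SteinbergElt.

(** * Reversing the blocks of a parabolic subgroup *)
Section BlockReversal.
Variables (n : nat) (F : finFieldType).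
Local Notation N := n.-1.+1.
Local Notation GL := {'GL_n[F]}.
Variable P : {group GL}.
Hypothesis BP : borel n F \subset P.
Implicit Types (i j k l : 'I_N).
Local Notation linked := (linked P).

(** The total order of the indices in which the blocks are reversed and each
block keeps its order. *)
Definition block_prec i j : bool := if linked i j then (i < j)%N else (j < i)%N.

(** The blocks are intervals of indices, so two indices in different blocks compare
as their blocks do. *)
Lemma block_prec_trans i j k : block_prec i j -> block_prec j k -> block_prec i k.
Proof.
have convex := linked_convex BP.
have trans := @linked_trans n F P; have sym := @linked_sym n F P.
rewrite /block_prec; case Lij : (linked i j); case Ljk : (linked j k).
- by rewrite (trans _ _ _ Lij Ljk); apply: ltn_trans.
- have Nik : linked i k = false.
    by apply/negbTE/negP=> /(trans j i k); rewrite sym Lij Ljk => /(_ isT).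
  rewrite Nik => ij kj; rewrite ltnNge leq_eqVlt; apply/negP=> /predU1P[/val_inj e|ik].
    by rewrite e linked_refl in Nik.
  by have := convex _ _ _ ik kj Lij; rewrite Nik.
- have Nik : linked i k = false.
    by apply/negbTE/negP=> /(trans i k j); rewrite [linked k j]sym Ljk Lij => /(_ isT).
  rewrite Nik => ji jk; rewrite ltnNge leq_eqVlt; apply/negP=> /predU1P[/val_inj e|ik].
    by rewrite e linked_refl in Nik.
  have := convex _ _ _ ji ik Ljk; by rewrite sym Lij.
- move=> ji kj; case Lik : (linked i k); last exact: ltn_trans kj ji.
  have := convex _ _ _ kj ji; rewrite sym Lik => /(_ isT).
  by rewrite sym Ljk.
Qed.

Lemma block_prec_irr i : block_prec i i = false.
Proof. by rewrite /block_prec linked_refl ltnn. Qed.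

Lemma block_prec_total i j : i != j -> block_prec i j || block_prec j i.
Proof.
by rewrite /block_prec [linked j i]linked_sym -val_eqE neq_ltn; case: linked; rewrite // orbC.
Qed.

Definition block_rank k : nat := #|[set l | block_prec l k]|.

Lemma block_rank_lt i j : block_prec i j -> (block_rank i < block_rank j)%N.
Proof.
move=> ij; apply: proper_card; apply/properP; split.
  by apply/subsetP=> l; rewrite !inE => /block_prec_trans; apply.
by exists i; rewrite inE ?ij ?block_prec_irr.
Qed.

Lemma block_rank_bound k : (block_rank k < N)%N.
Proof.
rewrite -[X in (_ < X)%N]card_ord -cardsT; apply: proper_card.
apply/properP; split; first exact: subsetT.
by exists k; rewrite ?inE ?block_prec_irr.
Qed.

Lemma block_rank_ltE i j : (block_rank i < block_rank j)%N = block_prec i j.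
Proof.
apply/idP/idP; last exact: block_rank_lt.
have [->|ij] := eqVneq i j; first by rewrite ltnn.
case/orP: (block_prec_total ij) => // /block_rank_lt ji ij'.
by have := ltn_trans ji ij'; rewrite ltnn.
Qed.

Lemma block_rank_inj : injective (fun k => Ordinal (block_rank_bound k)).
Proof.
move=> i j [e]; apply/eqP; apply: contraTT isT => /block_prec_total.
by rewrite -!block_rank_ltE e ltnn.
Qed.

Definition block_rev : 'S_N := perm block_rank_inj.

Lemma block_rev_lt i j : (block_rev i < block_rev j)%N = block_prec i j.
Proof. by rewrite !permE /= block_rank_ltE. Qed.

Lemma block_rev_succ i j : j = i.+1 :> nat -> linked i j ->
  block_rev j = (block_rev i).+1 :> nat.
Proof.
move=> ij1 Lij; rewrite !permE /= /block_rank.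
have -> : [set l | block_prec l j] = i |: [set l | block_prec l i].
  apply/setP=> l; rewrite !inE /block_prec.
  have -> : linked l j = linked l i.
    apply/idP/idP => [lj | li]; last exact: linked_trans li Lij.
    by apply: linked_trans lj _; rewrite linked_sym.
  have [->|li] := eqVneq l i; first by rewrite linked_refl ij1 ltnSn.
  case: (boolP (linked l i)) => [_|Nli] /=.
    by rewrite ij1 ltnS leq_eqVlt val_eqE (negPf li).
  rewrite ij1 ltn_neqAle.
  case: eqP => //= e; have ej : l = j by apply: val_inj; rewrite /= ij1.
  by rewrite ej linked_sym Lij in Nli.
by rewrite cardsU1 inE block_prec_irr.
Qed.

(** In the reversed order, i and j follow each other and are not swapped: they
are in the same block, and an index between them would come between. *)
Lemma block_rev_succ_inv i j : block_rev j = (block_rev i).+1 :> nat -> (i < j)%N ->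
  j = i.+1 :> nat /\ linked i j.
Proof.
move=> e ij; have pij : block_prec i j by rewrite -block_rev_lt e.
have Lij : linked i j by move: pij; rewrite /block_prec; case: ifP => // _; lia.
split=> //; apply/eqP; rewrite eqn_leq ij andbT leqNgt; apply/negP=> lt.
pose k := Ordinal (ltn_trans lt (ltn_ord j)).
have Lik : linked i k by apply: (linked_convex BP) Lij.
have : block_prec i k by rewrite /block_prec Lik /=.
have : block_prec k j.
  by rewrite /block_prec (linked_trans _ Lij) // linked_sym.
by rewrite -!block_rev_lt e ltnS leqNgt => /negP h1 /h1.
Qed.

End BlockReversal.

(** * The form on the Steinberg ideal and eigenvectors of the unitriangular group *)

Section SteinbergVectors.
Variables (n : nat) (F : finFieldType) (R : idomainType).
Hypothesis charR : [pchar R] =i pred0.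
Local Notation N := n.-1.+1.
Local Notation GL := {'GL_n[F]}.
Local Notation RG := (group_ring R GL).
Local Notation w := (@perm_GL n F).
Local Notation U := (@unitri n F 1%g).
Local Notation B := (borel n F).
Local Notation eps := (steinberg_elt n F R).
Local Notation I := (@steinberg_ideal n F R).
Implicit Types (x y a z : RG) (s t : 'S_N) (g h u v b : GL) (i j k l : 'I_N).
Implicit Types (r : R) (lam : GL -> R).

Lemma natR_neq0 m : (0 < m)%N -> m%:R != 0 :> R.
Proof. by rewrite ((pcharf0P _).1 charR) lt0n. Qed.

(** The alternating sum over the standard apartment, which is f(x, eps) when x is in
the Steinberg ideal. *)
Definition apt_sum x : R := \sum_(s : 'S_N) (-1) ^+ (s : bool) * x (w s).

Lemma apt_sum_scalar r x : apt_sum (gr_scalar r * x) = r * apt_sum x.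
Proof.
rewrite /apt_sum mulr_sumr; apply: eq_bigr => s _.
by rewrite gr_scalarM mulrCA.
Qed.

Lemma sum_steinberg_elt z : z \in I ->
  \sum_g eps g * z g = #|B|%:R * apt_sum z.
Proof.
move=> zI; under eq_bigr => g _ do rewrite steinberg_eltE mulr_suml.
rewrite exchange_big mulr_sumr; apply: eq_bigr => s _ /=.
rewrite (reindex_inj (mulgI (w s))) /=.
under eq_bigr => g _ do rewrite mulKg -mulrA.
rewrite -mulr_sumr mulrCA; congr (_ * _).
rewrite (eq_bigr (fun g => if g \in B then z (w s) else 0)) => [|g _].
  by rewrite -big_mkcond sumr_const mulr_natl.
case: ifP => gB; last by rewrite mul0r.
by rewrite mul1r (steinberg_ideal_borel _ zI gB).
Qed.

Lemma sum_steinberg_ideal a x : x \in I ->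
  \sum_g x g * (a * eps) g = #|B|%:R * apt_sum (gr_anti a * x).
Proof.
move=> xI; rewrite -sum_steinberg_elt; last exact: steinberg_idealM.
rewrite -gr_adj_anti -gr_adjP; apply: eq_bigr => g _; exact: mulrC.
Qed.

(** Symmetry of the form; the factor |B| cancels in characteristic 0. *)
Lemma apt_sum_anti a : apt_sum (gr_anti a * eps) = apt_sum (a * eps).
Proof.
apply: (mulfI (natR_neq0 (cardG_gt0 (borel_group n F)))).
rewrite -sum_steinberg_ideal ?steinberg_elt_in //.
by rewrite -sum_steinberg_elt // steinberg_idealM // steinberg_elt_in.
Qed.

Lemma steinberg_formE a x : x \in I ->
  steinberg_form x (a * eps) = FracField.tofrac (apt_sum (gr_anti a * x)).
Proof.
move=> xI; rewrite /steinberg_form sum_steinberg_ideal // rmorphM rmorph_nat /=.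
rewrite mulrC mulKf //.
rewrite -(rmorph_nat (@FracField.tofrac R)) tofrac_eq0.
exact: natR_neq0 (cardG_gt0 (borel_group n F)).
Qed.

(** By adjunction, f(x, a eps) is the alternating sum of the adjoint of a times x. *)
Lemma lattice_predP (l c : nat) x :
  reflect (x \in I /\ forall a, exists r, apt_sum (a * x) = l%:R ^+ c * r)
          (x \in @lattice_pred n F R l c).
Proof.
apply: (iffP (asboolP _)) => -[xI H]; split=> //.
  move=> a; have [|r] := H (gr_anti a * eps).
    by apply/steinberg_idealP; eexists.
  rewrite steinberg_formE // gr_antiK => /eqP; rewrite tofrac_eq => /eqP.
  by exists r.
move=> _ /steinberg_idealP[a ->]; have [r e] := H (gr_anti a).
by exists r; rewrite steinberg_formE // e.
Qed.

Definition unitri_char lam := lam 1%g = 1 /\ {in U &, {morph lam : u v / (u * v)%g >-> u * v}}.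
Definition dual_char lam : GL -> R := fun u => lam u^-1%g.

Lemma unitri_charV lam u : unitri_char lam -> u \in U -> lam u * lam u^-1%g = 1.
Proof. by move=> [lam1 lamM] uU; rewrite -lamM ?unitriV // mulgV. Qed.

Lemma dual_charP lam : unitri_char lam -> unitri_char (dual_char lam).
Proof.
move=> [lam1 lamM]; split; first by rewrite /dual_char invg1.
move=> u v uU vU; rewrite /dual_char mulrC -lamM ?unitriV //.
by rewrite invMg.
Qed.

(** Up to the factor |U|, the idempotent of the character inverse to lam. *)
Definition char_sum lam : RG := unitri_comb lam.
Definition char_vec lam : RG := char_sum lam * eps.

Lemma char_vec_in lam : char_vec lam \in I.
Proof. by apply: steinberg_idealM; apply: steinberg_elt_in. Qed.

Lemma char_vecE lam g : char_vec lam g = \sum_(u in U) lam u * eps (u^-1 * g)%g.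
Proof. exact: unitri_combM. Qed.

Lemma unitri_Mr u v : u \in U -> ((u * v)%g \in U) = (v \in U).
Proof.
move=> uU; apply/idP/idP => [uvU|]; last exact: unitriM.
by rewrite -(mulKg u v); apply: unitriM => //; apply: unitriV.
Qed.

Lemma unitri_V s u : (u^-1%g \in unitri F s) = (u \in unitri F s).
Proof. by apply/idP/idP => [/unitriV|/unitriV//]; rewrite invgK. Qed.

Lemma char_sum_comb lam f : unitri_char lam ->
  char_sum lam * unitri_comb f =
  gr_scalar (\sum_(u in U) dual_char lam u * f u) * char_sum lam.
Proof.
move=> [_ lamM]; apply: gr_ext => g; rewrite gr_scalarM unitri_combM [in RHS]ffunE.
have [gU|gU] := ifPn; last first.
  rewrite mulr0 big1 // => u uU; rewrite ffunE unitri_Mr ?unitri_V //.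
  by rewrite (negPf gU) mulr0.
rewrite mulr_suml (reindex_inj (inj_comp (mulgI g) invg_inj)) /=.
apply: eq_big => u; first by rewrite unitri_Mr ?unitri_V.
rewrite unitri_Mr // unitri_V => uU; rewrite mulV_cancel ffunE uU.
by rewrite lamM ?unitriV // -mulrA mulrC.
Qed.

(** E_lam u = lam(u)^-1 E_lam for u in U, and the ideal is RU . eps. *)
Lemma char_sum_mul lam x : unitri_char lam -> x \in I ->
  exists r, char_sum lam * x = gr_scalar r * char_vec lam.
Proof.
move=> lamP xI; rewrite (steinberg_ideal_unitri charR xI) mulrA char_sum_comb //.
by eexists; rewrite -mulrA.
Qed.

Lemma char_sum_sq lam : unitri_char lam ->
  char_sum lam * char_sum lam = gr_scalar #|U|%:R * char_sum lam.
Proof.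
move=> lamP; rewrite {2}/char_sum char_sum_comb //; congr (gr_scalar _ * _).
rewrite (eq_bigr (fun _ => 1)) => [|u uU]; last by rewrite mulrC unitri_charV.
by rewrite sumr_const.
Qed.

Lemma char_sum_anti lam : gr_anti (char_sum lam) = char_sum (dual_char lam).
Proof. by apply: gr_ext => g; rewrite gr_antiE !ffunE unitri_V. Qed.

Lemma char_vec_translate lam u g : unitri_char lam -> u \in U ->
  char_vec lam (u * g)%g = lam u * char_vec lam g.
Proof.
move=> [_ lamM] uU; rewrite !char_vecE mulr_sumr (reindex_inj (mulgI u)) /=.
apply: eq_big => v; first by rewrite unitri_Mr.
rewrite unitri_Mr // => vU; rewrite lamM // mulrA; congr (_ * eps _).
by rewrite invMg -mulgA mulKg.
Qed.

Lemma char_vec_perm lam s :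
  char_vec lam (w s) = (-1) ^+ (s : bool) * \sum_(u in U :&: unitri F s) lam u.
Proof.
rewrite char_vecE mulr_sumr [RHS](eq_bigl (fun u => (u \in U) && (u \in unitri F s))); last first.
  by move=> u; rewrite inE.
rewrite [RHS]big_mkcondr; apply: eq_bigr => u uU.
rewrite steinberg_elt_cell; last exact: unitriV.
by rewrite unitri_V; case: ifP; rewrite ?mulr1 ?mulr0 // mulrC.
Qed.

Lemma apt_sum_char_vec lam :
  apt_sum (char_vec lam) = \sum_(s : 'S_N) \sum_(u in U :&: unitri F s) lam u.
Proof.
apply: eq_bigr => s _; rewrite char_vec_perm mulrA -signr_addb addbb mul1r.
by [].
Qed.

(** Move everything to the other side of the form and use that the adjoint of E_lam
maps the ideal into the line of the dual eigenvector. *)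
Lemma apt_sum_mul_char_vec lam a : unitri_char lam ->
  exists r, apt_sum (a * char_vec lam) = r * apt_sum (char_vec (dual_char lam)).
Proof.
move=> lamP; rewrite /char_vec mulrA -apt_sum_anti gr_antiM char_sum_anti -mulrA.
have [|r ->] := @char_sum_mul (dual_char lam) (gr_anti a * eps) (dual_charP lamP).
  by apply: steinberg_idealM; apply: steinberg_elt_in.
by exists r; rewrite apt_sum_scalar.
Qed.

End SteinbergVectors.

(** * Additive characters and the order of the unitriangular group *)
Section AdditiveChar.
Variables (F : finFieldType) (R : idomainType).

Definition addchar (chi : F -> R) :=
  chi 0 = 1 /\ {morph chi : a b / a + b >-> a * b}.

(** Raise z to a coordinate of the field, seen as a vector space over its prime
field. *)
Lemma addchar_exists p (z : R) : p \in [pchar F] -> p.-primitive_root z ->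
  exists chi, addchar chi /\ exists c, chi c != 1.
Proof.
move=> pF prim_z; have p_pr := pcharf_prime pF.
have [phi phi_lin [psi phiK _]] := pprimeChar_vectAxiom pF.
have phiD a b : phi (a + b) = phi a + phi b.
  have := phi_lin 1 a b; by rewrite !scale1r.
have phi0 : phi 0 = 0.
  by apply: (addrI (phi 0)); rewrite -phiD !addr0.
have [i phi1] : exists i, phi 1 0 i != 0.
  apply/existsP; apply: contraT; rewrite negb_exists => /forallP H.
  case/eqP: (oner_neq0 F); apply: (can_inj phiK); rewrite phi0.
  by apply/rowP=> i; rewrite mxE; apply/eqP; move: (H i); rewrite negbK.
exists (fun a => z ^+ (phi a 0 i : nat)); split; [split|].
- by rewrite phi0 mxE.
- have modE m k : k = p -> z ^+ (m %% k) = z ^+ m by move=> ->; exact: prim_expr_mod.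
  by move=> a b; rewrite phiD mxE -exprD; apply: modE; exact: Fp_cast.
exists 1; rewrite -(prim_order_dvd prim_z) gtnNdvd ?lt0n //.
rewrite -[X in (_ < X)%N](Fp_cast p_pr); exact: ltn_ord.
Qed.
End AdditiveChar.

Section CardUnitri.
Variables (n : nat) (F : finFieldType).
Local Notation N := n.-1.+1.
Local Notation GL := {'GL_n[F]}.
Local Notation U := (@unitri n F 1%g).

(** U is the set of functions on pairs of indices with prescribed values off the
upper triangle, so |U| is a product of factors |F| and 1. *)
Lemma card_unitri_coprime p l :
  p \in [pchar F] -> prime l -> l != p -> coprime #|U| l.
Proof.
move=> pF l_pr lp; have p_pr := pcharf_prime pF.
pose Fam (x : 'I_N * 'I_N) : pred F :=
  if (x.1 < x.2)%N then predT else pred1 (x.1 == x.2)%:R.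
pose f (g : GL) : {ffun 'I_N * 'I_N -> F} := [ffun x => GLval g x.1 x.2].
have f_inj : injective f.
  move=> g h /ffunP e; apply/val_inj/matrixP=> i j.
  by have := e (i, j); rewrite !ffunE.
have eqU : f @: U =i family Fam.
  move=> v; apply/imsetP/familyP => [[g gU ->] x | vF].
    rewrite /Fam ffunE; case: ifPn => // lt; rewrite inE; apply/eqP.
    by apply: (unitriP _ _ gU); rewrite !perm1.
  pose M : 'M[F]_N := \matrix_(i, j) v (i, j).
  have HM i j : ~~ ((1%g : 'S_N) i < (1%g : 'S_N) j)%N -> M i j = (i == j)%:R.
    rewrite !perm1 mxE => lt; have := vF (i, j); rewrite /Fam /= (negPf lt) inE.
    by move/eqP.
  exists (Sub M (unitri_mx_unit HM)); first by apply/unitriP=> i j; exact: HM.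
  by apply/ffunP=> -[i j]; rewrite ffunE /= mxE.
rewrite -(card_imset U f_inj) (eq_card eqU) card_family.
have coF : coprime #|F| l.
  have -> : #|F| = (p ^ logn p #|F|)%N := card_pprimeChar pF.
  rewrite coprimeXl // prime_coprime // dvdn_prime2 //.
  by rewrite eq_sym.
rewrite /image_mem; elim: (enum _) => [|x e IHe] /=; first by rewrite coprime1n.
rewrite coprimeMl IHe andbT /Fam; case: ifP => _; first by rewrite (@eq_card _ _ F).
by rewrite card1 coprime1n.
Qed.
End CardUnitri.

(** * Characters of the unitriangular group attached to parabolics *)
Section ParabolicChar.
Variables (n : nat) (F : finFieldType) (R : idomainType).
Hypothesis charR : [pchar R] =i pred0.
Local Notation N := n.-1.+1.
Local Notation GL := {'GL_n[F]}.
Local Notation RG := (group_ring R GL).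
Local Notation w := (@perm_GL n F).
Local Notation U := (@unitri n F 1%g).
Variable chi : F -> R.
Hypothesis chiP : addchar chi.
Implicit Types (x y a z : RG) (s t : 'S_N) (g h u v b : GL) (i j k l : 'I_N).
Implicit Types (P : {group GL}).

(** On U this is additive, so that an additive character of the field turns it into
a linear character of U. *)
Definition superdiag P u : F :=
  \sum_(i : 'I_N) \sum_(j : 'I_N | (j == i.+1 :> nat) && linked P i j) GLval u i j.

Lemma superdiag1 P : superdiag P 1%g = 0.
Proof.
rewrite /superdiag big1 // => i _; rewrite big1 // => j /andP[/eqP ij1 _].
by rewrite GL_1E mxE -val_eqE ltn_eqF //= ij1.
Qed.

Lemma superdiagM P : {in U &, {morph superdiag P : u v / (u * v)%g >-> u + v}}.
Proof.
move=> u v uU vU; rewrite /superdiag -big_split /=; apply: eq_bigr => i _.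
rewrite -big_split /=; apply: eq_bigr => j /andP[/eqP ij1 _].
have ij : i != j by rewrite -val_eqE ltn_eqF //= ij1.
rewrite GL_mulE (bigD1 i) //= (bigD1 j) 1?eq_sym //= (unitri_diag _ uU) (unitri_diag _ vU).
rewrite mul1r mulr1 big1 ?addr0; first by rewrite addrC.
move=> k /andP[ki kj]; have [ltik|leki] := ltnP i k.
  rewrite [GLval v k j](unitri_eq0 vU) ?mulr0 // !perm1 -leqNgt ltnW //.
  by rewrite ltn_neqAle eq_sym val_eqE kj /= ij1.
by rewrite (unitri_eq0 uU) ?mul0r 1?eq_sym // !perm1 -leqNgt.
Qed.

Definition parchar P : GL -> R := chi \o superdiag P.

Lemma parcharP P : unitri_char (parchar P).
Proof.
have [chi0 chiD] := chiP; split; first by rewrite /parchar /= superdiag1.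
by move=> u v uU vU; rewrite /parchar /= superdiagM.
Qed.

Lemma superdiag_elem P i j c : j = i.+1 :> nat -> linked P i j ->
  superdiag P (elem i j c) = c.
Proof.
move=> ij1 Lij; have ij : i != j by rewrite -val_eqE ltn_eqF //= ij1.
rewrite /superdiag (bigD1 i) //= (bigD1 j) /=; last by rewrite ij1 eqxx.
rewrite elemE // (negPf ij) !eqxx add0r mulr1 !big1 ?addr0 //.
  move=> k ki; rewrite big1 // => l /andP[/eqP kl1 _].
  by rewrite elemE // (negPf ki) mulr0 addr0 -val_eqE ltn_eqF //= kl1.
move=> l /andP[/andP[/eqP il1 _] lj].
by rewrite elemE // (negPf lj) andbF mulr0 addr0 -val_eqE ltn_eqF //= il1.
Qed.

(** Chain the adjacent inequalities from i to j; by linked_convex the indices in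
between are in the same block. *)
Lemma block_incr_adj P s : borel n F \subset P ->
  (forall i j, j = i.+1 :> nat -> linked P i j -> (s i < s j)%N) -> block_incr P s.
Proof.
move=> BP H; apply/block_incrP=> i j.
have [m] := ubnP (j - i)%N; elim: m i => // m IHm i lem ij Lij.
have [e|ne] := eqVneq (nat_of_ord j) i.+1; first exact: H.
have lt : (i.+1 < j)%N by rewrite ltn_neqAle eq_sym ne.
pose k := Ordinal (ltn_trans lt (ltn_ord j)).
have Lik : linked P i k by apply: (linked_convex BP) Lij.
apply: ltn_trans (H i k _ Lik) _ => //.
by apply: IHm; rewrite /= ?(linked_trans _ Lij) 1?linked_sym //; lia.
Qed.

(** If s has an ascent inside a block of P at adjacent indices, the character is
nontrivial on U :&: unitri s and the sum vanishes; otherwise the entries that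
occur in superdiag vanish on this subgroup. *)
Lemma sum_parchar P s : borel n F \subset P -> (exists c, chi c != 1) ->
  \sum_(u in U :&: unitri F s) parchar P u =
  (if block_incr P (s * w0 n)%g then #|U :&: unitri F s| else 0)%:R.
Proof.
move=> BP [c chic]; have [chi0 chiD] := chiP.
have [_ parM] := parcharP P.
have [/block_incrP sI|] := boolP (block_incr _ _).
  rewrite (eq_bigr (fun _ => 1)) ?sumr_const // => u /setIP[uU us].
  rewrite /parchar /= /superdiag big1 ?chi0 // => i _.
  rewrite big1 // => j /andP[/eqP ij1 Lij].
  have ij : (i < j)%N by rewrite ij1.
  have := sI i j ij Lij; rewrite lt_mulw0 => sji.
  apply: (unitri_eq0 us); first by rewrite -val_eqE ltn_eqF.
  by rewrite -leqNgt ltnW.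
move=> nincr.
have [i [j [ij1 Lij sij]]] : exists i j, [/\ j = i.+1 :> nat, linked P i j & (s i < s j)%N].
  apply/not_existsP => H; case/negP: nincr; apply: block_incr_adj => // i j ij1 Lij.
  rewrite lt_mulw0 ltnNge leq_eqVlt; apply/negP=> /predU1P[/val_inj/perm_inj e|sij].
    by move: ij1; rewrite e => /n_Sn.
  by apply: (H i); exists j.
pose e := elem i j c; have eU : e \in U by apply: elem_unitri; rewrite !perm1 ij1.
have es : e \in unitri F s by apply: elem_unitri.
have pe : parchar P e = chi c by rewrite /parchar /= superdiag_elem.
apply: (@sum_group_char0 _ _ (unitri_group F 1%g :&: unitri_group F s)%G _ e).
- by move=> u v /setIP[uU _] /setIP[vU _]; apply: parM.
- by rewrite inE eU.
- by rewrite pe.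
Qed.

Lemma apt_sum_parchar P : borel n F \subset P -> (exists c, chi c != 1) ->
  apt_sum (char_vec (parchar P)) = #|'GL_n[F] : P|%g%:R.
Proof.
move=> BP chi1; rewrite apt_sum_char_vec (index_parabolic BP) natr_sum.
rewrite (reindex_inj (mulIg (w0 n))) /= [RHS]big_mkcond /=; apply: eq_bigr => s _.
by rewrite sum_parchar // -mulgA w0K mulg1; case: ifP.
Qed.

Section Reversal.
Variable P : {group GL}.
Hypothesis BP : borel n F \subset P.
Local Notation theta := (block_rev BP).
Local Notation G := [set: GL]%G.
Local Notation y := (w theta^-1%g).

Lemma linkedT i j : linked G i j. Proof. by rewrite /linked inE. Qed.

(** Successors inside a block stay successors after the reversal, and no other
ascending pair of indices becomes successive. *)
Lemma superdiag_rev (x : GL) : x \in unitri F theta^-1%g -> x \in U ->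
  superdiag P (y^-1 * x * y)%g = superdiag G x.
Proof.
move=> xt xU; rewrite /superdiag [RHS](reindex_inj (@perm_inj _ theta)) /=.
apply: eq_bigr => i _; rewrite [RHS](reindex_inj (@perm_inj _ theta)) /=.
rewrite big_mkcond [RHS]big_mkcond /=; apply: eq_bigr => j _.
rewrite permJVE invgK linkedT andbT.
case: ifP => [/andP[/eqP ij1 Lij]|Nij].
  by rewrite (block_rev_succ BP ij1 Lij) eqxx.
case: eqP => // e; apply/esym/eqP; apply: contraFT Nij => nz.
have tij : theta i != theta j by rewrite -val_eqE ltn_eqF //= e.
have := unitri_neq0 xt tij nz; rewrite !permK => ij.
by have [-> ->] := block_rev_succ_inv e ij; rewrite eqxx.
Qed.

Lemma superdiag_rev_opp v : v \in unitri F (w0 n) ->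
  superdiag P (y^-1 * v * y)%g = 0.
Proof.
move=> vU; rewrite /superdiag big1 // => i _; rewrite big1 // => j /andP[/eqP ij1 Lij].
have e := block_rev_succ BP ij1 Lij.
rewrite permJVE invgK (unitri_eq0 vU) //.
  by rewrite -val_eqE ltn_eqF //= e.
by rewrite lt_w0 -leqNgt e leqnSn.
Qed.

Lemma char_vec_big_cell (lam : GL -> R) : unitri_char lam ->
  char_vec lam (w (w0 n)) = (-1) ^+ (w0 n : bool).
Proof.
have := unitri_opp_cap F (1%g : 'S_N); rewrite mul1g => cap [lam1 _].
rewrite char_vec_perm cap.
by rewrite (big_pred1 1%g) ?lam1 ?mulr1 // => u; rewrite !inE.
Qed.

(** Split y u^-1 y^-1 into an upper factor x and a lower factor v.  The lower factor
is absorbed by w w0; both characters agree on x, as reversing the blocks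
matches the superdiagonal entries, and the two contributions cancel. *)
Lemma char_vec_reversal u : u \in U ->
  parchar P u * char_vec (parchar G) (y * (u^-1 * (y^-1 * w (w0 n))))%g =
  (-1) ^+ (w0 n : bool).
Proof.
move=> uU; have u'U : (y * u^-1 * y^-1)%g \in unitri F theta^-1%g.
  by rewrite -[X in unitri F X]mulg1 unitriJ; apply: unitriV.
move: (u'U); rewrite {1}(unitri_decomp F theta^-1%g 1%g) mul1g.
case/mulsgP => x v /setIP[xt xU] /setIP[vt vU] exv.
have [chi0 chiD] := chiP; have parP := parcharP.
rewrite (conj_assoc _ exv) (char_vec_translate _ (parP G) xU).
rewrite (@steinberg_ideal_borel n F R _ (w (w0 n))); first last.
- by apply: (subsetP (unitri_sub_borel n F)); rewrite unitriJV.
- exact: char_vec_in.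
rewrite char_vec_big_cell // mulrA.
suff -> : parchar G x = parchar P u^-1%g by rewrite unitri_charV ?mul1r.
rewrite (conj_split exv) /parchar /= superdiagM ?unitriJV //.
by rewrite superdiag_rev // superdiag_rev_opp // addr0.
Qed.

(** The scalar r is found by evaluating both sides at y^-1 w0, where the left-hand
side is |U| up to sign by char_vec_reversal. *)
Lemma char_sum_reversal : exists r r',
  char_sum (parchar P) * (gr_elt R y^-1%g * char_vec (parchar G)) =
    gr_scalar r * char_vec (parchar P) /\ r * r' = #|U|%:R.
Proof.
have [|r e] := @char_sum_mul n F R charR (parchar P)
   (gr_elt R y^-1%g * char_vec (parchar G)) (parcharP P).
  by apply: steinberg_idealM; apply: char_vec_in.
pose g0 := (y^-1 * w (w0 n))%g.
exists r, ((-1) ^+ (w0 n : bool) * char_vec (parchar P) g0); split=> //.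
rewrite mulrCA -gr_scalarM -e unitri_combM.
rewrite (eq_bigr (fun _ => (-1) ^+ (w0 n : bool))) => [|u uU]; last first.
  by rewrite gr_eltM invgK; exact: char_vec_reversal.
by rewrite sumr_const mulrnAr -signr_addb addbb.
Qed.
End Reversal.
End ParabolicChar.

(** * Separating the reductions *)
Section Modules.

Lemma linear_iso (A : pzRingType) (U V : lmodType A) (f : U -> V) :
  (forall a, {morph f : u v / a *: u + v}) -> injective f ->
  (forall v, exists u, f u = v) -> lmod_iso U V.
Proof.
move=> lf f_inj /choice[g gK].
pose m := GRing.isLinear.Build _ _ _ _ f lf.
pose f' : {linear U -> V} := HB.pack f m.
exists f'; exists g => [u|]; last exact: gK.
by apply: f_inj; rewrite gK.
Qed.

Variables (R : comPzRingType) (gT : finGroupType) (l : nat).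
Local Notation RG := (group_ring R gT).

Lemma reduction_lmod_iso (M N : lmodType RG) :
  lmod_iso M N ->
  lmod_iso (reduction M l : lmodType (group_ring (reduction R l) gT))
    (reduction N l).
Proof.
case=> f [g fK gK]; pose F (t : reduction M l) : reduction N l := red l (f (repr t)).
have FE x : F (red l x) = red l (f x).
  rewrite /F; have [y ->] := repr_red l x; apply/redP; exists (f y).
  by rewrite linearD linearMn addrC addKr.
apply: (@linear_iso _ _ _ F).
- move=> a s t; rewrite -[s]red_repr -[t]red_repr -[a]gr_liftK.
  rewrite -[_ *: red l _]red_scaleE -redD !FE.
  by rewrite -[_ *: red l _]red_scaleE -redD linearP.
- move=> s t; rewrite -[s]red_repr -[t]red_repr !FE => /redP[y e]; apply/redP.
  by exists (g y); apply: (can_inj fK); rewrite linearB e linearMn; congr (_ *+ l); rewrite gK.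
move=> t; exists (red l (g (repr t))); rewrite FE gK; exact: red_repr.
Qed.

(** Any isomorphism of the reductions would carry the vanishing of X from M/lM to
N/lN, and an isomorphism of the modules reduces to one. *)
Lemma reduction_not_iso (M N : lmodType RG) (X : RG) :
  (forall x : M, exists y, X *: x = y *+ l) ->
  (exists x : N, forall y, X *: x <> y *+ l) ->
  ~ lmod_iso (reduction M l : lmodType (group_ring (reduction R l) gT))
    (reduction N l) /\ ~ lmod_iso M N.
Proof.
move=> HM [x HN]; have main : ~ lmod_iso
    (reduction M l : lmodType (group_ring (reduction R l) gT)) (reduction N l).
  case=> f [g fK gK].
  have /redP[y] : red l (X *: x) = red l 0; last by rewrite subr0; exact: HN.
  rewrite red_scaleE -[red l x]gK -[g _]red_repr.
  have -> : red_scale (gr_red l X) (f (red l (repr (g (red l x))))) =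
     f (gr_red l X *: red l (repr (g (red l x)))) by rewrite linearZ.
  have [y e] := HM (repr (g (red l x))).
  rewrite -[_ *: red l _]red_scaleE e.
  have red0 (V : zmodType) : red l (0 : V) = 0 := raddf0 \pi_(reduction V l)%qT.
  have -> : red l (y *+ l) = red l 0 by apply/redP; exists y; rewrite subr0.
  by rewrite !red0 linear0.
by split=> // /reduction_lmod_iso.
Qed.
End Modules.

Section Final.
Variables (n : nat) (F : finFieldType) (p l : nat) (R : idomainType).
Hypothesis charF : p \in [pchar F].
Hypothesis l_pr : prime l.
Hypothesis l_neq_p : l != p.
Hypothesis charR : [pchar R] =i pred0.
Hypothesis l_nonunit : forall r : R, l%:R * r <> 1.
Local Notation N := n.-1.+1.
Local Notation GL := {'GL_n[F]}.
Local Notation RG := (group_ring R GL).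
Local Notation w := (@perm_GL n F).
Local Notation U := (@unitri n F 1%g).
Local Notation eps := (steinberg_elt n F R).
Local Notation I := (@steinberg_ideal n F R).
Local Notation Ic := (@lattice_pred n F R l).
Implicit Types (x y a z : RG) (r : R).

Lemma l_neq0 : l%:R != 0 :> R.
Proof. by apply: natR_neq0 => //; apply: prime_gt0. Qed.

(** Bezout: m is invertible modulo l^k. *)
Lemma coprime_cancel m k r r' : coprime m l ->
  m%:R * r = l%:R ^+ k * r' -> exists r'', r = l%:R ^+ k * r''.
Proof.
move=> co e; have lk : (0 < l ^ k)%N by rewrite expn_gt0 prime_gt0.
have [a _ /dvdnP[c]] := Bezoutl m lk.
have /eqP -> : coprime (l ^ k) m by rewrite coprime_sym coprimeXr.
move=> /(congr1 (fun m => m%:R : R)); rewrite natrD !natrM natrX => ac.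
exists (c%:R * r - a%:R * r').
transitivity ((c%:R * l%:R ^+ k) * r - a%:R * (l%:R ^+ k * r')); last by ring.
by rewrite -ac -e; ring.
Qed.

Lemma coprime_not_multiple m r : coprime m l -> m%:R != l%:R * r.
Proof.
move=> co; apply/eqP=> e; have [|r' e'] := @coprime_cancel m 1 1 r co.
  by rewrite mulr1 expr1.
by apply: (@l_nonunit r'); rewrite [RHS]e' expr1.
Qed.

Lemma index_split (P : {group GL}) : exists2 m, coprime m l &
  #|'GL_n[F] : P|%g = (m * l ^ logn l #|'GL_n[F] : P|%g)%N.
Proof.
have [m co e] := pfactor_coprime l_pr (indexg_gt0 'GL_n[F] P).
by exists m; rewrite // coprime_sym.
Qed.

Lemma apt_sum_dual (lam : GL -> R) :
  apt_sum (char_vec (dual_char lam)) = apt_sum (char_vec lam).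
Proof.
rewrite !apt_sum_char_vec; apply: eq_bigr => s _.
rewrite [RHS](reindex_inj invg_inj) /=; apply: eq_bigl => u.
by rewrite !in_setI !unitri_V.
Qed.

Lemma lattice_scale x r c : x \in I ->
  (forall a, exists r', r * apt_sum (a * x) = l%:R ^+ c * r') ->
  (gr_scalar r * x : RG) \in Ic c.
Proof.
move=> xI H; apply/(lattice_predP charR); split; first exact: steinberg_idealM.
by move=> a; rewrite gr_scalarCA apt_sum_scalar.
Qed.

Section Separation.
Variable chi : F -> R.
Hypothesis chiP : addchar chi.
Hypothesis chi1 : exists c, chi c != 1.
Variable P : {group GL}.
Hypothesis BP : borel n F \subset P.
Local Notation y := (w (block_rev BP)^-1%g).
Local Notation lamG := (parchar chi [set: GL]%G).
Local Notation lamP := (parchar chi P).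
Local Notation lamG' := (dual_char lamG).
Local Notation lamP' := (dual_char lamP).

(** The dual characters occur because the adjoint of sep_elt is then
E_lamP * y^-1 * E_lamG, to which char_sum_reversal applies. *)
Definition sep_elt : RG := char_sum lamG' * gr_elt R y * char_sum lamP'.

Let lamGP : unitri_char lamG := parcharP chiP _.
Let lamPP : unitri_char lamP := parcharP chiP _.
Let lamG'P : unitri_char lamG' := dual_charP lamGP.
Let lamP'P : unitri_char lamP' := dual_charP lamPP.

Lemma apt_sum_lamG : apt_sum (char_vec lamG') = 1.
Proof.
by rewrite apt_sum_dual (apt_sum_parchar chiP) ?subsetT // indexgg.
Qed.

Lemma apt_sum_lamP : apt_sum (char_vec lamP') = #|'GL_n[F] : P|%g%:R.
Proof. by rewrite apt_sum_dual (apt_sum_parchar chiP). Qed.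

Lemma apt_sum_mul_lamP a : exists r,
  apt_sum (a * char_vec lamP') = r * #|'GL_n[F] : P|%g%:R.
Proof.
have [r e] := apt_sum_mul_char_vec charR a lamP'P.
by exists r; rewrite e apt_sum_dual apt_sum_lamP.
Qed.

(** The image of the ideal is in |G : P| R e, where e is the eigenvector of the
character dual to lamG, and dividing by l leaves a multiple of l^c e, which belongs
to I(c). *)
Lemma sep_elt_kills c x : (c < logn l #|'GL_n[F] : P|%g)%N -> x \in Ic c ->
  exists2 z, z \in Ic c & sep_elt * x = z *+ l.
Proof.
move=> ca /(lattice_predP charR)[xI _].
have [r1 e1] := char_sum_mul charR lamP'P xI.
have [|r2 e2] := @char_sum_mul n F R charR lamG' (gr_elt R y * char_vec lamP') lamG'P.
  by apply: steinberg_idealM; apply: char_vec_in.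
have [r3 e3] := apt_sum_mul_lamP (char_sum lamG' * gr_elt R y).
have er2 : r2 = r3 * #|'GL_n[F] : P|%g%:R.
  by rewrite -e3 -mulrA e2 apt_sum_scalar apt_sum_lamG mulr1.
have [m _ em] := index_split P; set k := logn l _ in ca em.
have k_gt0 : (0 < k)%N := leq_ltn_trans (leq0n c) ca.
(* r2 = r3 |G : P| = r3 m l^k, and one factor l is split off. *)
pose r := r1 * (r3 * m%:R) * l%:R ^+ k.-1.
exists (gr_scalar r * char_vec lamG').
  apply: lattice_scale => [|a]; first exact: char_vec_in.
  have ek : k.-1 = (c + (k.-1 - c))%N by rewrite subnKC // -ltnS prednK.
  by rewrite /r ek exprD; eexists; rewrite !mulrA [_ * l%:R ^+ c]mulrC -!mulrA.
rewrite -gr_scalar_nat mulrA gr_scalarMM /sep_elt -!mulrA e1 !gr_scalarCA e2.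
rewrite mulrA gr_scalarMM; congr (gr_scalar _ * _).
have ek : l%:R ^+ k = l%:R * l%:R ^+ k.-1 :> R by rewrite -exprS prednK.
rewrite er2 em natrM natrX /r ek.
by rewrite -!mulrA [RHS]mulrCA; congr (_ * _); rewrite [RHS]mulrCA; congr (_ * _); exact: mulrCA.
Qed.

(** The witness is l^(h - a) times the eigenvector of the character dual to lamP,
with a the valuation of |G : P|; pairing its image with eps gives l^h times a
divisor of a number prime to l, whereas elements of l I(h) pair to multiples of
l^(h+1). *)
Lemma sep_elt_survives h : (logn l #|'GL_n[F] : P|%g <= h)%N ->
  exists2 x, x \in Ic h & forall z, z \in Ic h -> sep_elt * x <> z *+ l.
Proof.
move=> ah; have [m com em] := index_split P; set k := logn l _ in ah em.
exists (gr_scalar (l%:R ^+ (h - k)) * char_vec lamP').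
  apply: lattice_scale => [|a]; first exact: char_vec_in.
  have [r ->] := apt_sum_mul_lamP a; exists (r * m%:R).
  rewrite em natrM natrX -[in RHS](subnK ah) exprD.
  by move: (l%:R ^+ (h - k) : R) (l%:R ^+ k : R) (m%:R : R) => A B C; ring.
move=> z /(lattice_predP charR)[_ /(_ 1)[r' er']] e.
have [r [r2 [er rr2]]] := char_sum_reversal charR chiP BP.
have e1 : apt_sum (sep_elt * eps) = r * #|'GL_n[F] : P|%g%:R.
  rewrite -(apt_sum_anti charR) /sep_elt !gr_antiM -!char_sum_anti !gr_antiK gr_anti_elt -!mulrA er.
  by rewrite apt_sum_scalar -apt_sum_dual apt_sum_lamP.
have := congr1 (@apt_sum n F R) e.
rewrite gr_scalarCA apt_sum_scalar -gr_scalar_nat apt_sum_scalar -[z]mul1r er'.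
have -> : sep_elt * char_vec lamP' = gr_scalar #|U|%:R * (sep_elt * eps).
  rewrite /sep_elt /char_vec -!mulrA [char_sum lamP' * (_ * _)]mulrA char_sum_sq //.
  by rewrite -!mulrA !gr_scalarCA.
rewrite apt_sum_scalar e1 em natrM natrX => e2.
(* r * r2 = |U| turns r into a divisor of an integer prime to l. *)
have co : coprime (#|U| * #|U| * m) l.
  by rewrite !coprimeMl com !(card_unitri_coprime n charF).
have /negP[] := coprime_not_multiple (r' * r2) co; apply/eqP.
apply: (mulfI (expf_neq0 h l_neq0)).
have -> : l%:R ^+ h * (l%:R * (r' * r2)) = l%:R * (l%:R ^+ h * r') * r2 :> R by ring.
rewrite -e2 -{1}(subnK ah) exprD !natrM -{2}rr2.
by move: (l%:R ^+ (h - k) : R) (l%:R ^+ k : R) (m%:R : R) => A B C; ring.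
Qed.
End Separation.

End Final.

(** * The range where the lattices are stable *)
Section Stable.
Variables (n : nat) (F : finFieldType) (l : nat) (R : idomainType).
Hypothesis l_pr : prime l.
Hypothesis charR : [pchar R] =i pred0.
Local Notation N := n.-1.+1.
Local Notation GL := {'GL_n[F]}.
Local Notation RG := (group_ring R GL).
Local Notation w := (@perm_GL n F).
Local Notation U := (@unitri n F 1%g).
Local Notation B := (borel_group n F).
Local Notation eps := (steinberg_elt n F R).
Local Notation I := (@steinberg_ideal n F R).
Local Notation Ic := (@lattice_pred n F R l).
Implicit Types (x y a z : RG) (r : R).

Lemma linked_borel (i j : 'I_N) : (i < j)%N -> linked B i j = false.
Proof.
move=> ij; apply/negbTE/negP=> /borelP/(_ j i ij)/eqP.
by rewrite /= !mxE tpermR eqxx oner_eq0.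
Qed.

Lemma apt_sum_char_vec1 (chi : F -> R) : addchar chi -> (exists c, chi c != 1) ->
  apt_sum (@char_vec n F R (fun=> 1)) = #|'GL_n[F] : borel n F|%g%:R :> R.
Proof.
move=> chiP chi1; rewrite -(apt_sum_parchar chiP (subxx B) chi1) !apt_sum_char_vec.
apply: eq_bigr => s _; apply: eq_bigr => u _.
rewrite /parchar /= /superdiag big1 ?chiP.1 // => i _.
by rewrite big1 // => j /andP[/eqP ij1]; rewrite linked_borel ?ij1.
Qed.

Lemma unitri_char1 : @unitri_char n F R (fun=> 1).
Proof. by split=> // u v _ _; rewrite mulr1. Qed.

(** E_1 g^-1 x is a multiple of e_1 (trivial character); the scalar is read off at
the identity, where summing over U only multiplies by |U| because x is constant on
the cosets of B. *)
Lemma index_value (chi : F -> R) x g : addchar chi -> (exists c, chi c != 1) -> x \in I ->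
  apt_sum (@char_sum n F R (fun=> 1) * gr_elt R g^-1%g * x) =
  #|'GL_n[F] : borel n F|%g%:R * x g.
Proof.
move=> chiP chi1 xI; rewrite -mulrA; pose z := gr_elt R g^-1%g * x.
have zI : z \in I by apply: steinberg_idealM.
have z1 : z 1%g = x g by rewrite gr_eltM invgK mulg1.
have [r e] := char_sum_mul charR unitri_char1 zI.
have U0 : #|U|%:R != 0 :> R by apply: natR_neq0 => //; apply: (cardG_gt0 (unitri_group F 1%g)).
suff er : r = x g by rewrite e apt_sum_scalar er (apt_sum_char_vec1 chiP chi1) mulrC.
have char_vec1 : @char_vec n F R (fun=> 1) 1%g = #|U|%:R.
  have := @char_vec_perm n F R (fun=> 1) 1%g.
  by rewrite perm_GL1 odd_perm1 expr0 mul1r setIid sumr_const.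
apply: (mulIf U0); rewrite -[in LHS]char_vec1 -gr_scalarM -e.
rewrite unitri_combM (eq_bigr (fun _ => x g)) => [|u uU].
  by rewrite sumr_const mulr_natr.
rewrite mul1r -z1 mulg1 -[u^-1%g]mul1g; apply: steinberg_ideal_borel => //.
by apply: (subsetP (unitri_sub_borel n F)); apply: unitriV.
Qed.

Lemma lattice_succ c x : x \in Ic c -> (x *+ l : RG) \in Ic c.+1.
Proof.
move=> /(lattice_predP charR)[xI H]; rewrite -gr_scalar_nat.
apply: lattice_scale => // a; have [r ->] := H a.
by exists r; rewrite mulrA exprS.
Qed.

(** The hypothesis on c leaves at least one factor l in every value of x by
index_value; dividing the coordinates of x on the translates of eps shows that the
quotient is in the ideal. *)
Lemma lattice_divide (chi : F -> R) c x : addchar chi -> (exists d, chi d != 1) ->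
  (logn l #|'GL_n[F] : borel n F|%g <= c)%N ->
  x \in Ic c.+1 -> exists2 y, y \in Ic c & x = y *+ l.
Proof.
move=> chiP chi1 + /(lattice_predP charR)[xI H].
have := index_split l_pr B; rewrite /= => -[m co].
move: (logn l _) => b em bc.
have div g : exists r, x g = l%:R * r.
  have [r e] := H (@char_sum n F R (fun=> 1) * gr_elt R g^-1%g).
  rewrite (index_value _ chiP chi1 xI) in e.
  have [|r' ->] := coprime_cancel l_pr (k := c.+1 - b) (r := x g) (r' := r) co.
    apply: (mulfI (expf_neq0 b (l_neq0 l_pr charR))).
    by rewrite [RHS]mulrA -exprD (subnKC (leqW bc)) -e em natrM natrX mulrA [_ * m%:R]mulrC.
  by rewrite subSn // exprS -mulrA; eexists.
have [f fE] := choice div.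
pose y := unitri_comb (fun u => (-1) ^+ (w0 n : bool) * f (u * w (w0 n))%g) * eps.
have xy : x = y *+ l.
  rewrite -gr_scalar_nat {1}(steinberg_ideal_unitri charR xI) mulrA; congr (_ * _).
  apply: gr_ext => g; rewrite gr_scalarM !ffunE; case: ifP; last by rewrite mulr0.
  by rewrite fE mulrCA.
exists y => //; apply/(lattice_predP charR); split.
  by apply/steinberg_idealP; eexists.
move=> a; have [r] := H a; rewrite xy -gr_scalar_nat gr_scalarCA apt_sum_scalar.
rewrite exprS -mulrA => /(mulfI (l_neq0 l_pr charR)) ->; by exists r.
Qed.

Lemma lattice_val_mulrn c (x : lattice n F R l c) : val (x *+ l) = val x *+ l.
Proof. exact: raddfMn. Qed.

Lemma lattice_iso_succ (chi : F -> R) c : addchar chi -> (exists d, chi d != 1) ->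
  (logn l #|'GL_n[F] : borel n F|%g <= c)%N ->
  lmod_iso (lattice n F R l c) (lattice n F R l c.+1).
Proof.
move=> chiP chi1 bc.
pose f (x : lattice n F R l c) : lattice n F R l c.+1 :=
  Sub (val x *+ l) (lattice_succ (valP x)).
apply: (@linear_iso _ _ _ f).
- by move=> a u v; apply: val_inj; rewrite /= mulrnDl scalerMnr.
- move=> u v /(congr1 val) /= e; apply: val_inj; apply: gr_ext => g.
  apply: (mulfI (l_neq0 l_pr charR)); rewrite !mulr_natl.
  by have := congr1 (fun a : RG => a g) e; rewrite /= !gr_mulrnE.
move=> v; have [y yI e] := lattice_divide chiP chi1 bc (valP v).
by exists (Sub y yI); apply: val_inj.
Qed.
End Stable.

Theorem theorem7p2 (n : nat) (F : finFieldType) (p l : nat) (R : idomainType)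
    (n_ge2 : (2 <= n)%N) (charF : p \in [pchar F])
    (l_prime : prime l) (l_neq_p : l != p)
    (charR : [pchar R] =i pred0)
    (pidR : principal_ideal_ring R)
    (localR : local_ring_with_maximal_ideal (nat_multiples R l))
    (rootR : exists z : R, p.-primitive_root z) :
  let RG := group_ring R {'GL_n[F]} in
  let KG := group_ring (reduction R l) {'GL_n[F]} in
  let I (c : nat) : lmodType RG := lattice n F R l c in
  let T (c : nat) : lmodType KG := reduction (I c) l in
  let b := logn l #|'GL_n[F] : borel n F|%g in
  [/\ forall c h : nat, (c < h)%N ->
        (exists a : nat, P_value n F l a /\ (c < a <= h)%N) ->
        ~ lmod_iso (T c) (T h) /\ ~ lmod_iso (I c) (I h),
      forall c h : nat, (c < h)%N -> P_value n F l h ->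
        ~ lmod_iso (T c) (T h) /\ ~ lmod_iso (I c) (I h),
      forall c h : nat, (c < h)%N -> P_value n F l c -> P_value n F l h ->
        ~ lmod_iso (T c) (T h) /\ ~ lmod_iso (I c) (I h),
      forall m : nat, (b <= m)%N -> lmod_iso (I m) (I m.+1)
    & forall m : nat, (b <= m)%N -> lmod_iso (T m) (T m.+1)].
Proof.
move=> RG KG I T b.
have [z /(addchar_exists charF)[chi [chiP chi1]]] := rootR.
have l_nonunit (r : R) : l%:R * r <> 1.
  have [[[_ l1 _] _] _] := localR.
  by move=> e; case/negP: l1; apply/asboolP; exists r; rewrite -mulr_natl.
have sep c h : (c < h)%N -> (exists a : nat, P_value n F l a /\ (c < a <= h)%N) ->
    ~ lmod_iso (T c) (T h) /\ ~ lmod_iso (I c) (I h).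
  move=> _ [_ [[P [BP ->]] /andP[ca ah]]].
  apply: (@reduction_not_iso R _ l (I c) (I h) (sep_elt chi BP)) => [x|].
    have [y yI e] := sep_elt_kills l_prime charR chiP chi1 BP ca (valP x).
    by exists (Sub y yI); apply: val_inj; rewrite lattice_val_mulrn.
  have [x xI H] := sep_elt_survives charF l_prime l_neq_p charR l_nonunit chiP chi1 BP ah.
  exists (Sub x xI) => y /(congr1 val) e; apply: (H _ (valP y)).
  by rewrite -lattice_val_mulrn -e.
have iso m : (b <= m)%N -> lmod_iso (I m) (I m.+1).
  exact: (lattice_iso_succ l_prime charR chiP chi1).
split=> // [c h ch hP | c h ch _ hP | m bm]; first 2 last.
- exact/reduction_lmod_iso/iso.
- by apply: sep => //; exists h; rewrite ch leqnn.
- by apply: sep => //; exists h; rewrite ch leqnn.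
Qed.
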